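(* If $\kappa$ is a weakly Ramsey cardinal, then $\kappa$ is weakly ineffable and $\kappa$ is a limit of ineffable cardinals.
   Context: ${\rm ZFC}^-$ denotes ZF without the Powerset axiom together with the axiom that every set is bijective with some ordinal. A weak $\kappa$-model is a transitive set $M$ of cardinality $\kappa$ with $\kappa\in M$ and $M\models{\rm ZFC}^-$. Sources and targets of elementary embeddings are transitive. An elementary embedding $j:M\to N$ is $\kappa$-powerset preserving if it has critical point $\kappa$ and $M$ and $N$ have exactly the same subsets of $\kappa$. A cardinal $\kappa$ is weakly Ramsey if every $A\subseteq\kappa$ is an element of some weak $\kappa$-model $M$ for which there exists a $\kappa$-powerset preserving elementary embedding $j:M\to N$. An uncountable regular cardinal $\kappa$ is ineffable if for every sequence $\langle A_\alpha\mid\alpha<\kappa\rangle$ with $A_\alpha\subseteq\alpha$ there is $A\subseteq\kappa$ such that $\{\alpha<\kappa\mid A\cap\alpha=A_\alpha\}$ is stationary; it is weakly ineffable if for every such sequence there is such an $A$ for which this set has cardinality $\kappa$. *)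

(* Defs.v *)
Class Membership (X : Type) : Type := mem : X -> X -> Prop.

Declare Scope st_scope.
Delimit Scope st_scope with st.
Notation "x ∈ y" := (mem x y) (at level 70, no associativity) : st_scope.
Open Scope st_scope.

(** All set-theoretic notions are stated for an arbitrary structure (X, ∈), with
    functions and sequences being elements of X (sets of Kuratowski pairs), so that
    they can be interpreted both in the universe and in a transitive set M. *)

Definition subset {X : Type} {E : Membership X} (x y : X) : Prop :=
  forall z, z ∈ x -> z ∈ y.
Notation "x ⊆ y" := (subset x y) (at level 70, no associativity) : st_scope.

Definition is_empty {X : Type} {E : Membership X} (x : X) : Prop :=
  forall z, ~ z ∈ x.

Definition is_upair {X : Type} {E : Membership X} (p x y : X) : Prop :=
  forall z, z ∈ p <-> z = x \/ z = y.

Definition is_pair {X : Type} {E : Membership X} (p x y : X) : Prop :=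
  exists a b, is_upair a x x /\ is_upair b x y /\ is_upair p a b.

Definition is_union {X : Type} {E : Membership X} (u x : X) : Prop :=
  forall z, z ∈ u <-> exists y, y ∈ x /\ z ∈ y.

Definition is_succ {X : Type} {E : Membership X} (s x : X) : Prop :=
  forall z, z ∈ s <-> z ∈ x \/ z = x.

Definition is_transitive {X : Type} {E : Membership X} (x : X) : Prop :=
  forall y, y ∈ x -> y ⊆ x.

(** In the presence of Foundation, ∈-comparability of the elements of a suffices
    for a to be well-ordered by ∈. *)
Definition is_ordinal {X : Type} {E : Membership X} (a : X) : Prop :=
  is_transitive a /\
  forall x y, x ∈ a -> y ∈ a -> x ∈ y \/ x = y \/ y ∈ x.

(** [maps f x y]: the ordered pair (x, y) belongs to f, i.e. f(x) = y. *)
Definition maps {X : Type} {E : Membership X} (f x y : X) : Prop :=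
  exists p, is_pair p x y /\ p ∈ f.

Definition function_on {X : Type} {E : Membership X} (f a : X) : Prop :=
  (forall p, p ∈ f -> exists x y, x ∈ a /\ is_pair p x y) /\
  (forall x, x ∈ a -> exists! y, maps f x y).

Definition is_function {X : Type} {E : Membership X} (f a b : X) : Prop :=
  function_on f a /\ forall x y, maps f x y -> y ∈ b.

Definition is_bijection {X : Type} {E : Membership X} (f a b : X) : Prop :=
  is_function f a b /\
  (forall x x' y, maps f x y -> maps f x' y -> x = x') /\
  (forall y, y ∈ b -> exists x, maps f x y).

Definition equinumerous {X : Type} {E : Membership X} (a b : X) : Prop :=
  exists f, is_bijection f a b.

Definition is_cardinal {X : Type} {E : Membership X} (k : X) : Prop :=
  is_ordinal k /\ forall a, a ∈ k -> ~ equinumerous a k.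

Definition has_cardinality {X : Type} {E : Membership X} (x k : X) : Prop :=
  is_cardinal k /\ equinumerous x k.

Definition is_limit {X : Type} {E : Membership X} (a : X) : Prop :=
  is_ordinal a /\ (exists x, x ∈ a) /\
  forall x, x ∈ a -> exists y, y ∈ a /\ x ∈ y.

Definition is_omega {X : Type} {E : Membership X} (w : X) : Prop :=
  is_limit w /\ forall n, n ∈ w -> ~ is_limit n.

Definition uncountable_cardinal {X : Type} {E : Membership X} (k : X) : Prop :=
  is_cardinal k /\ exists w, is_omega w /\ w ∈ k.

(** An infinite cardinal into which no smaller ordinal maps cofinally. *)
Definition regular_cardinal {X : Type} {E : Membership X} (k : X) : Prop :=
  is_cardinal k /\ is_limit k /\
  forall a f, a ∈ k -> is_function f a k ->
    exists b, b ∈ k /\ forall x y, maps f x y -> y ∈ b.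

Definition unbounded_in {X : Type} {E : Membership X} (c a : X) : Prop :=
  forall b, b ∈ a -> exists x, x ∈ c /\ x ∈ a /\ b ∈ x.

Definition club {X : Type} {E : Membership X} (c k : X) : Prop :=
  c ⊆ k /\ unbounded_in c k /\
  forall a, a ∈ k -> is_limit a -> unbounded_in c a -> a ∈ c.

Definition stationary {X : Type} {E : Membership X} (s k : X) : Prop :=
  s ⊆ k /\ forall c, club c k -> exists x, x ∈ c /\ x ∈ s.

(** [d] is a sequence (A_α | α < k) with A_α ⊆ α for all α < k. *)
Definition subset_sequence {X : Type} {E : Membership X} (d k : X) : Prop :=
  function_on d k /\ forall a y, maps d a y -> y ⊆ a.

(** s = { α < k | A ∩ α = A_α }, where A_α = d(α). *)
Definition is_agreement_set {X : Type} {E : Membership X} (s d A k : X) : Prop :=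
  forall a, a ∈ s <->
    a ∈ k /\ exists y, maps d a y /\ forall z, z ∈ y <-> z ∈ A /\ z ∈ a.

Definition ineffable {X : Type} {E : Membership X} (k : X) : Prop :=
  uncountable_cardinal k /\ regular_cardinal k /\
  forall d, subset_sequence d k ->
    exists A s, A ⊆ k /\ is_agreement_set s d A k /\ stationary s k.

Definition weakly_ineffable {X : Type} {E : Membership X} (k : X) : Prop :=
  uncountable_cardinal k /\ regular_cardinal k /\
  forall d, subset_sequence d k ->
    exists A s, A ⊆ k /\ is_agreement_set s d A k /\ has_cardinality s k.

Definition limit_of {X : Type} {E : Membership X} (P : X -> Prop) (k : X) : Prop :=
  is_limit k /\ forall b, b ∈ k -> exists l, l ∈ k /\ b ∈ l /\ P l.

(** First-order formulas of the language {∈}, with de Bruijn indices. *)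
Inductive formula : Set :=
| f_mem (m n : nat)
| f_eq (m n : nat)
| f_bot
| f_imp (p q : formula)
| f_and (p q : formula)
| f_or (p q : formula)
| f_all (p : formula)
| f_ex (p : formula).

Definition scons {X : Type} (x : X) (v : nat -> X) : nat -> X :=
  fun n => match n with O => x | S m => v m end.

Fixpoint sat {X : Type} {E : Membership X} (v : nat -> X) (p : formula) : Prop :=
  match p with
  | f_mem m n => v m ∈ v n
  | f_eq m n => v m = v n
  | f_bot => False
  | f_imp p q => sat v p -> sat v q
  | f_and p q => sat v p /\ sat v q
  | f_or p q => sat v p \/ sat v q
  | f_all p => forall x, sat (scons x v) p
  | f_ex p => exists x, sat (scons x v) p
  end.

Definition ax_extensionality (X : Type) {E : Membership X} : Prop :=
  forall x y : X, (forall z, z ∈ x <-> z ∈ y) -> x = y.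

Definition ax_foundation (X : Type) {E : Membership X} : Prop :=
  forall x : X, (exists y, y ∈ x) -> exists y, y ∈ x /\ forall z, z ∈ y -> ~ z ∈ x.

Definition ax_pairing (X : Type) {E : Membership X} : Prop :=
  forall x y : X, exists p, is_upair p x y.

Definition ax_union (X : Type) {E : Membership X} : Prop :=
  forall x : X, exists u, is_union u x.

Definition ax_infinity (X : Type) {E : Membership X} : Prop :=
  exists w : X, (exists e, is_empty e /\ e ∈ w) /\
    forall x, x ∈ w -> exists s, is_succ s x /\ s ∈ w.

Definition ax_powerset (X : Type) {E : Membership X} : Prop :=
  forall x : X, exists p, forall z, z ∈ p <-> z ⊆ x.

Definition ax_well_ordering (X : Type) {E : Membership X} : Prop :=
  forall x : X, exists a, is_ordinal a /\ equinumerous x a.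

Definition separation_for {X : Type} {E : Membership X} (P : X -> Prop) : Prop :=
  forall x, exists y, forall z, z ∈ y <-> z ∈ x /\ P z.

Definition replacement_for {X : Type} {E : Membership X} (R : X -> X -> Prop) : Prop :=
  forall x,
    (forall y z z', y ∈ x -> R y z -> R y z' -> z = z') ->
    exists w, forall z, z ∈ w <-> exists y, y ∈ x /\ R y z.

Definition basic_axioms (X : Type) {E : Membership X} : Prop :=
  ax_extensionality X /\ ax_foundation X /\ ax_pairing X /\ ax_union X /\
  ax_infinity X /\ ax_well_ordering X.

(** (X, ∈) ⊨ ZFC^-: the schemes range over first-order formulas with parameters. *)
Definition models_ZFC_minus (X : Type) {E : Membership X} : Prop :=
  basic_axioms X /\
  (forall (p : formula) (v : nat -> X),
     separation_for (fun x => sat (scons x v) p)) /\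
  (forall (p : formula) (v : nat -> X),
     replacement_for (fun x y => sat (scons x (scons y v)) p)).

(** The ambient universe of sets. Its Separation and Replacement schemes range over
    arbitrary predicates of the metatheory, which play the role of classes.
    Hence its natural numbers are standard, and satisfaction in a set structure,
    defined above by recursion on [formula], is the internal notion of the universe. *)
Definition ZFC_universe (V : Type) {E : Membership V} : Prop :=
  basic_axioms V /\ ax_powerset V /\
  (forall P : V -> Prop, separation_for P) /\
  (forall R : V -> V -> Prop, replacement_for R).

(** The structure (M, ∈) given by an element M of the universe. *)
Definition elt {V : Type} {E : Membership V} (M : V) : Type := {x : V | x ∈ M}.

Definition val {V : Type} {E : Membership V} {M : V} (x : elt M) : V := proj1_sig x.

#[export] Instance elt_membership {V : Type} {E : Membership V} (M : V) :
  Membership (elt M) := fun x y => val x ∈ val y.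

Definition weak_model {V : Type} {E : Membership V} (k M : V) : Prop :=
  is_transitive M /\ has_cardinality M k /\ k ∈ M /\ models_ZFC_minus (elt M).

Definition elementary {V : Type} {E : Membership V} {M N : V}
    (j : elt M -> elt N) : Prop :=
  forall (p : formula) (v : nat -> elt M), sat v p <-> sat (fun n => j (v n)) p.

(** [k] is the least ordinal moved by [j]. *)
Definition critical_point {V : Type} {E : Membership V} {M N : V}
    (j : elt M -> elt N) (k : V) : Prop :=
  is_ordinal k /\
  (exists x : elt M, val x = k /\ val (j x) <> k) /\
  (forall x : elt M, val x ∈ k -> val (j x) = val x).

Definition powerset_preserving {V : Type} {E : Membership V} {M N : V}
    (k : V) (j : elt M -> elt N) : Prop :=
  is_transitive M /\ is_transitive N /\ elementary j /\ critical_point j k /\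
  forall x, x ⊆ k -> (x ∈ M <-> x ∈ N).

Definition weakly_Ramsey {V : Type} {E : Membership V} (k : V) : Prop :=
  is_cardinal k /\
  forall A, A ⊆ k ->
    exists M, weak_model k M /\ A ∈ M /\
      exists (N : V) (j : elt M -> elt N), powerset_preserving k j.

(* Main.v *)
(* Let k be weakly Ramsey and j : M -> N one of its embeddings.  The collapse of the Gödel
   well-ordering of k × k is the same in all the models M; by reflection its values lie
   below k, so it is an injection c : k × k -> k, and a sequence of k subsets of k can be put
   in M by coding it through c as a subset of k.
   Given a coded sequence (A_a | a < k) in M, let A be the k-th term of its image under j,
   intersected with k.  It belongs to N, hence to M.  As j(A) ∩ k = A, the image of the
   sequence agrees with j(A) at k; so whenever C in M has k in j(C), some a in C satisfies
   A ∩ a = A_a.  Taking for C the final segments of k gives weak ineffability, and taking for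
   C the clubs of k in M, which are those in N, shows that k is ineffable in N.
   Weak ineffability makes k a strong limit, so one more coding gives an M containing all
   bounded subsets of k.  Then N believes that there is an ineffable cardinal below j(k) above
   any b < k, so M believes that there is one below k, and M is right about it. *)
From Stdlib Require Import Classical ClassicalEpsilon.
Require Import Defs.

(** * Foundation and ordered pairs in the universe *)

Section Universe.
Context {V : Type} {E : Membership V} (HV : ZFC_universe V).

Lemma set_ext (x y : V) : (forall z, z ∈ x <-> z ∈ y) -> x = y.
Proof. apply HV. Qed.

Lemma sep_V (P : V -> Prop) (x : V) : exists y, forall z, z ∈ y <-> z ∈ x /\ P z.
Proof. apply HV. Qed.

Lemma mem_minimal (P : V -> Prop) (a : V) :
  (exists x, x ∈ a /\ P x) ->
  exists x, x ∈ a /\ P x /\ forall y, y ∈ x -> y ∈ a -> ~ P y.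
Proof.
  intros [x [xa Px]]. destruct (sep_V P a) as [b Hb].
  destruct HV as [[_ [Hf _]] _].
  destruct (Hf b) as [y [yb Hy]].
  - exists x. apply Hb. auto.
  - apply Hb in yb. exists y. split; [apply yb|split; [apply yb|]].
    intros z zy za Pz. apply (Hy z zy). apply Hb. auto.
Qed.

Lemma pairing (x y : V) : exists p, is_upair p x y.
Proof. apply HV. Qed.

Lemma mem_asym (x y : V) : x ∈ y -> ~ y ∈ x.
Proof.
  intros xy yx. destruct (pairing x y) as [p Hp].
  destruct (mem_minimal (fun _ => True) p) as [z [zp [_ Hz]]].
  - exists x. split; [apply Hp|]; auto.
  - apply Hp in zp. destruct zp; subst z.
    + apply (Hz y yx); [apply Hp|]; auto.
    + apply (Hz x xy); [apply Hp|]; auto.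
Qed.

Lemma mem_irrefl (x : V) : ~ x ∈ x.
Proof. intros h. exact (mem_asym x x h h). Qed.

Lemma upair_unique (p q x y : V) : is_upair p x y -> is_upair q x y -> p = q.
Proof. intros Hp Hq. apply set_ext. intros z. now rewrite (Hp z), (Hq z). Qed.

Lemma pair_exists (x y : V) : exists p, is_pair p x y.
Proof.
  destruct (pairing x x) as [a Ha], (pairing x y) as [b Hb], (pairing a b) as [p Hp].
  exists p, a, b. auto.
Qed.

Definition op (x y : V) : V :=
  proj1_sig (constructive_indefinite_description _ (pair_exists x y)).

Lemma is_pair_op (x y : V) : is_pair (op x y) x y.
Proof. exact (proj2_sig (constructive_indefinite_description _ (pair_exists x y))). Qed.

Lemma is_pairE (p x y : V) : is_pair p x y <-> p = op x y.
Proof.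
  split; [|intros ->; apply is_pair_op].
  intros [a [b [Ha [Hb Hp]]]]. destruct (is_pair_op x y) as [a' [b' [Ha' [Hb' Hp']]]].
  rewrite (upair_unique _ _ _ _ Ha' Ha), (upair_unique _ _ _ _ Hb' Hb) in Hp'.
  exact (upair_unique _ _ _ _ Hp Hp').
Qed.

Lemma is_pair_inj (p x y x' y' : V) :
  is_pair p x y -> is_pair p x' y' -> x = x' /\ y = y'.
Proof.
  intros [a [b [Ha [Hb Hp]]]] [a' [b' [Ha' [Hb' Hp']]]].
  assert (Hx : x = x').
  { assert (x ∈ a') as h.
    { assert (a' ∈ p) as h by (apply Hp'; auto). apply Hp in h.
      destruct h; subst; [apply Ha|apply Hb]; auto. }
    apply Ha' in h. tauto. }
  split; [exact Hx|]. subst x'.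
  assert (y = x \/ y = y') as h1.
  { assert (b ∈ p) as h by (apply Hp; auto). apply Hp' in h.
    assert (y ∈ b) as k by (apply Hb; auto).
    destruct h; subst b; [apply Ha' in k|apply Hb' in k]; tauto. }
  assert (y' = x \/ y' = y) as h2.
  { assert (b' ∈ p) as h by (apply Hp'; auto). apply Hp in h.
    assert (y' ∈ b') as k by (apply Hb'; auto).
    destruct h; subst b'; [apply Ha in k|apply Hb in k]; tauto. }
  destruct h1, h2; congruence.
Qed.

Lemma op_inj (x y x' y' : V) : op x y = op x' y' -> x = x' /\ y = y'.
Proof.
  intros h. apply (is_pair_inj (op x y)); [|rewrite h]; apply is_pair_op.
Qed.

Lemma mapsE (f x y : V) : maps f x y <-> op x y ∈ f.
Proof.
  split.
  - intros [p [Hp pf]]. apply is_pairE in Hp. now subst.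
  - intros h. exists (op x y). split; [apply is_pair_op|exact h].
Qed.

Lemma op_in_trans (M x y : V) : is_transitive M -> op x y ∈ M -> x ∈ M /\ y ∈ M.
Proof.
  intros tM h. destruct (is_pair_op x y) as [a [b [Ha [Hb Hp]]]].
  assert (b ∈ M) by (apply (tM _ h), Hp; auto).
  split; apply (tM b); auto; apply Hb; auto.
Qed.

Lemma op_mem_trans (M f x y : V) :
  is_transitive M -> f ∈ M -> op x y ∈ f -> x ∈ M /\ y ∈ M.
Proof. intros tM fM h. apply (op_in_trans M); auto. exact (tM f fM _ h). Qed.

(** * Uniform definability over transitive sets *)

(* A single formula must work in all transitive [M], so that such [F] transfer along
   elementary embeddings.  [F] receives [M] in order to quantify over all of [M]. *)
Definition Def (F : V -> (nat -> V) -> Prop) : Prop :=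
  exists p, forall M, is_transitive M -> forall v : nat -> elt M,
    sat v p <-> F M (fun n => val (v n)).

(** Absoluteness enters here: [M] is transitive and the parameters lie in [M], so quantifiers over
    the universe may be replaced by ones restricted to [M] or to a parameter. *)
Lemma def_ext (F G : V -> (nat -> V) -> Prop) :
  (forall M v, is_transitive M -> (forall n, v n ∈ M) -> (F M v <-> G M v)) ->
  Def G -> Def F.
Proof.
  intros H [p Hp]. exists p. intros M tM v. rewrite (Hp M tM v). symmetry. apply H; auto.
  intros n. exact (proj2_sig (v n)).
Qed.

Lemma elt_eq {M : V} (x y : elt M) : val x = val y -> x = y.
Proof.
  destruct x as [x Hx], y as [y Hy]. cbn. intros ->. f_equal. apply proof_irrelevance.
Qed.

Lemma def_mem (i j : nat) : Def (fun M v => v i ∈ v j).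
Proof. exists (f_mem i j). intros M tM v. cbn. reflexivity. Qed.

Lemma def_eq (i j : nat) : Def (fun M v => v i = v j).
Proof.
  exists (f_eq i j). intros M tM v. cbn. split; [now intros ->|apply elt_eq].
Qed.

Lemma def_and (F G : V -> (nat -> V) -> Prop) :
  Def F -> Def G -> Def (fun M v => F M v /\ G M v).
Proof.
  intros [p Hp] [q Hq]. exists (f_and p q). intros M tM v. cbn.
  now rewrite (Hp M tM v), (Hq M tM v).
Qed.

Lemma def_or (F G : V -> (nat -> V) -> Prop) :
  Def F -> Def G -> Def (fun M v => F M v \/ G M v).
Proof.
  intros [p Hp] [q Hq]. exists (f_or p q). intros M tM v. cbn.
  now rewrite (Hp M tM v), (Hq M tM v).
Qed.

Lemma def_imp (F G : V -> (nat -> V) -> Prop) :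
  Def F -> Def G -> Def (fun M v => F M v -> G M v).
Proof.
  intros [p Hp] [q Hq]. exists (f_imp p q). intros M tM v. cbn.
  now rewrite (Hp M tM v), (Hq M tM v).
Qed.

Lemma def_iff (F G : V -> (nat -> V) -> Prop) :
  Def F -> Def G -> Def (fun M v => F M v <-> G M v).
Proof. intros HF HG. apply def_and; apply def_imp; assumption. Qed.

Lemma def_false : Def (fun M v => False).
Proof. exists f_bot. intros M tM v. reflexivity. Qed.

Lemma def_not (F : V -> (nat -> V) -> Prop) : Def F -> Def (fun M v => ~ F M v).
Proof. intros HF. apply def_imp; [assumption|apply def_false]. Qed.

Lemma def_exM (G : V -> V -> (nat -> V) -> Prop) :
  Def (fun M v => G M (v 0) (fun n => v (S n))) ->
  Def (fun M v => exists x, x ∈ M /\ G M x v).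
Proof.
  intros [p Hp]. exists (f_ex p). intros M tM v. cbn. split.
  - intros [x Hx]. apply (Hp M tM) in Hx. exists (val x). split; [exact (proj2_sig x)|exact Hx].
  - intros [x [xM Hx]]. exists (exist _ x xM). apply (Hp M tM). exact Hx.
Qed.

Lemma def_allM (G : V -> V -> (nat -> V) -> Prop) :
  Def (fun M v => G M (v 0) (fun n => v (S n))) ->
  Def (fun M v => forall x, x ∈ M -> G M x v).
Proof.
  intros [p Hp]. exists (f_all p). intros M tM v. cbn. split.
  - intros H x xM. exact (proj1 (Hp M tM _) (H (exist _ x xM))).
  - intros H x. apply (Hp M tM). exact (H (val x) (proj2_sig x)).
Qed.

Lemma def_exb (i : nat) (G : V -> V -> (nat -> V) -> Prop) :
  Def (fun M v => G M (v 0) (fun n => v (S n))) ->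
  Def (fun M v => exists x, x ∈ v i /\ G M x v).
Proof.
  intros H. apply def_ext with (fun M v => exists x, x ∈ M /\ x ∈ v i /\ G M x v).
  - intros M v tM vM. split.
    + intros [x [xi Hx]]. exists x. split; [exact (tM _ (vM i) _ xi)|auto].
    + intros [x [_ Hx]]. exists x. exact Hx.
  - apply def_exM with (G := fun M x v => x ∈ v i /\ G M x v).
    apply def_and; [exact (def_mem 0 (S i))|exact H].
Qed.

Lemma def_allb (i : nat) (G : V -> V -> (nat -> V) -> Prop) :
  Def (fun M v => G M (v 0) (fun n => v (S n))) ->
  Def (fun M v => forall x, x ∈ v i -> G M x v).
Proof.
  intros H. apply def_ext with (fun M v => forall x, x ∈ M -> x ∈ v i -> G M x v).
  - intros M v tM vM. split.
    + intros K x _. apply K.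
    + intros K x xi. apply K; [exact (tM _ (vM i) _ xi)|exact xi].
  - apply def_allM with (G := fun M x v => x ∈ v i -> G M x v).
    apply def_imp; [exact (def_mem 0 (S i))|exact H].
Qed.

Ltac def_step :=
  first [ apply def_mem | apply def_eq | apply def_false
        | apply def_exb | apply def_allb | apply def_exM | apply def_allM
        | apply def_and | apply def_or | apply def_iff | apply def_not | apply def_imp ].

Lemma def_upair (i j k : nat) : Def (fun M v => is_upair (v i) (v j) (v k)).
Proof.
  apply def_ext with (fun M v =>
    v j ∈ v i /\ v k ∈ v i /\ forall z, z ∈ v i -> z = v j \/ z = v k).
  - intros M v _ _. unfold is_upair. split.
    + intros H. split; [apply H|split; [apply H|]]; auto. intros z. apply H.
    + intros [H1 [H2 H3]] z. split; [apply H3|]. intros [->| ->]; auto.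
  - repeat def_step.
Qed.

Lemma def_op_eq (i j k : nat) : Def (fun M v => v i = op (v j) (v k)).
Proof.
  apply def_ext with (fun M v => exists a, a ∈ v i /\ exists b, b ∈ v i /\
    (is_upair a (v j) (v j) /\ is_upair b (v j) (v k) /\ is_upair (v i) a b)).
  - intros M v _ _. rewrite <- is_pairE. split.
    + intros [a [b [Ha [Hb Hp]]]]. exists a. split; [apply Hp; auto|].
      exists b. split; [apply Hp; auto|auto].
    + intros [a [_ [b [_ H]]]]. exists a, b. exact H.
  - repeat first [apply def_upair | def_step].
Qed.

Lemma def_op_mem (i j k : nat) : Def (fun M v => op (v i) (v j) ∈ v k).
Proof.
  apply def_ext with (fun M v => exists p, p ∈ v k /\ p = op (v i) (v j)).
  - intros M v _ _. split; [eauto|]. now intros [p [h ->]].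
  - apply def_exb. apply (def_op_eq 0 (S i) (S j)).
Qed.

(** The inner pair is an element of [M] by transitivity, so it can be quantified over. *)
Lemma def_op3_mem (i j l k : nat) : Def (fun M v => op (op (v i) (v j)) (v l) ∈ v k).
Proof.
  apply def_ext with
    (fun M v => exists q, q ∈ M /\ (q = op (v i) (v j) /\ op q (v l) ∈ v k)).
  - intros M v tM vM. split.
    + intros h. exists (op (v i) (v j)). split; [|auto].
      apply (op_mem_trans M _ _ _ tM (vM k) h).
    + now intros [q [_ [-> h]]].
  - apply def_exM. apply def_and;
      [apply (def_op_eq 0 (S i) (S j))|apply (def_op_mem 0 (S l) (S k))].
Qed.

(** Proves definability by recursion on the syntax; [tac] supplies further definable notions, and a
    relation assumed definable in the context is picked up as well. *)
Ltac def_with tac := repeat (cbv beta; first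
  [ tac | apply def_op_eq | apply def_op_mem | apply def_op3_mem | apply def_upair
  | match goal with H : forall i j, Def _ |- _ => apply H end | def_step ]).

Ltac def := def_with fail.

Lemma def_ordinal (i : nat) : Def (fun M v => is_ordinal (v i)).
Proof.
  apply def_ext with (fun M v =>
    (forall y, y ∈ v i -> forall z, z ∈ y -> z ∈ v i) /\
    (forall x, x ∈ v i -> forall y, y ∈ v i -> x ∈ y \/ x = y \/ y ∈ x)); [|def].
  intros M v _ _. split; intros [t l]; split; auto.
Qed.

Lemma def_limit (i : nat) : Def (fun M v => is_limit (v i)).
Proof.
  unfold is_limit.
  (* The conjunct [x = x] gives the existential the bounded shape expected by [def_exb]. *)
  apply def_ext with (fun M v =>
   is_ordinal (v i) /\ (exists x, x ∈ v i /\ x = x) /\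
   (forall x, x ∈ v i -> exists y, y ∈ v i /\ x ∈ y));
    [|def_with ltac:(apply def_ordinal)].
  intros M v _ _. split.
  - intros [O [[x xi] u]]. split; [exact O|split; [exists x|]]; auto.
  - intros [O [[x [xi _]] u]]. split; [exact O|split; [exists x|]]; auto.
Qed.

Lemma def_club (i j : nat) : Def (fun M v => club (v i) (v j)).
Proof.
  unfold club, unbounded_in, subset.
  def_with ltac:(apply def_limit).
Qed.

(** * Closure properties of transitive models *)

Definition model (M : V) : Prop := is_transitive M /\ models_ZFC_minus (elt M).

Section Model.
Context {M : V} (HM : model M).

Let tM : is_transitive M := proj1 HM.

(** Separation in [M], used from outside: four parameter slots cover every later use, and spare
    slots are filled by repeating a parameter. *)
Lemma model_sep (G : V -> V -> V -> V -> V -> V -> Prop) :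
  Def (fun M v => G M (v 0) (v 1) (v 2) (v 3) (v 4)) ->
  forall p q r s a, p ∈ M -> q ∈ M -> r ∈ M -> s ∈ M -> a ∈ M ->
  exists b, b ∈ M /\ forall z, z ∈ b <-> z ∈ a /\ G M z p q r s.
Proof.
  intros [f Hf] p q r s a Hp Hq Hr Hs Ha.
  destruct (proj2 HM) as [_ [sep _]].
  set (v := scons (exist _ p Hp) (scons (exist _ q Hq) (scons (exist _ r Hr)
              (fun _ => exist _ s Hs))) : nat -> elt M).
  destruct (sep f v (exist _ a Ha)) as [b Hb].
  exists (val b). split; [exact (proj2_sig b)|]. intros z. split.
  - intros zb. assert (zM : z ∈ M) by exact (tM _ (proj2_sig b) _ zb).
    destruct (proj1 (Hb (exist _ z zM)) zb) as [za Hz]. split; [exact za|].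
    exact (proj1 (Hf M tM _) Hz).
  - intros [za Hz]. assert (zM : z ∈ M) by exact (tM _ Ha _ za).
    apply (Hb (exist _ z zM)). split; [exact za|].
    apply (Hf M tM). exact Hz.
Qed.

Lemma model_repl (G : V -> V -> V -> V -> V -> V -> Prop) :
  Def (fun M v => G M (v 0) (v 1) (v 2) (v 3) (v 4)) ->
  forall p q r a, p ∈ M -> q ∈ M -> r ∈ M -> a ∈ M ->
  (forall y z z', y ∈ a -> z ∈ M -> z' ∈ M ->
     G M y z p q r -> G M y z' p q r -> z = z') ->
  exists b, b ∈ M /\ forall z, z ∈ b <-> z ∈ M /\ exists y, y ∈ a /\ G M y z p q r.
Proof.
  intros [f Hf] p q r a Hp Hq Hr Ha Hfun.
  destruct (proj2 HM) as [_ [_ repl]].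
  set (v := scons (exist _ p Hp) (scons (exist _ q Hq)
              (fun _ => exist _ r Hr)) : nat -> elt M).
  destruct (repl f v (exist _ a Ha)) as [b Hb].
  { intros y z z' ya H H'. apply elt_eq.
    apply (Hfun (val y) _ _ ya (proj2_sig z) (proj2_sig z')).
    - exact (proj1 (Hf M tM _) H).
    - exact (proj1 (Hf M tM _) H'). }
  exists (val b). split; [exact (proj2_sig b)|]. intros z. split.
  - intros zb. assert (zM : z ∈ M) by exact (tM _ (proj2_sig b) _ zb).
    destruct (proj1 (Hb (exist _ z zM)) zb) as [y [ya Hy]]. split; [exact zM|].
    exists (val y). split; [exact ya|]. exact (proj1 (Hf M tM _) Hy).
  - intros [zM [y [ya Hy]]]. assert (yM : y ∈ M) by exact (tM _ Ha _ ya).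
    apply (Hb (exist _ z zM)). exists (exist _ y yM). split; [exact ya|].
    apply (Hf M tM). exact Hy.
Qed.

Lemma model_upair (x y : V) : x ∈ M -> y ∈ M -> exists p, p ∈ M /\ is_upair p x y.
Proof.
  intros xM yM. destruct (proj2 HM) as [[_ [_ [Hp _]]] _].
  destruct (Hp (exist _ x xM) (exist _ y yM)) as [p Hpp].
  exists (val p). split; [exact (proj2_sig p)|]. intros z. split.
  - intros zp. assert (zM : z ∈ M) by exact (tM _ (proj2_sig p) _ zp).
    destruct (proj1 (Hpp (exist _ z zM)) zp) as [h|h]; apply (f_equal val) in h; auto.
  - intros [->| ->].
    + apply (Hpp (exist _ x xM)). auto.
    + apply (Hpp (exist _ y yM)). auto.
Qed.

Lemma model_op (x y : V) : x ∈ M -> y ∈ M -> op x y ∈ M.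
Proof.
  intros xM yM. destruct (model_upair x x xM xM) as [a [aM Ha]],
    (model_upair x y xM yM) as [b [bM Hb]], (model_upair a b aM bM) as [p [pM Hp]].
  replace (op x y) with p; [exact pM|]. apply is_pairE. exists a, b. auto.
Qed.

Lemma model_union (x : V) : x ∈ M -> exists u, u ∈ M /\ is_union u x.
Proof.
  intros xM. destruct (proj2 HM) as [[_ [_ [_ [Hu _]]]] _].
  destruct (Hu (exist _ x xM)) as [u Huu].
  exists (val u). split; [exact (proj2_sig u)|]. intros z. split.
  - intros zu. assert (zM : z ∈ M) by exact (tM _ (proj2_sig u) _ zu).
    destruct (proj1 (Huu (exist _ z zM)) zu) as [y [yx zy]]. exists (val y). auto.
  - intros [y [yx zy]].
    assert (yM : y ∈ M) by exact (tM _ xM _ yx).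
    assert (zM : z ∈ M) by exact (tM _ yM _ zy).
    apply (Huu (exist _ z zM)). exists (exist _ y yM). auto.
Qed.

Lemma model_adjoin (x y : V) :
  x ∈ M -> y ∈ M -> exists u, u ∈ M /\ forall z, z ∈ u <-> z ∈ x \/ z = y.
Proof.
  intros xM yM. destruct (model_upair y y yM yM) as [s [sM Hs]],
    (model_upair x s xM sM) as [p [pM Hp]], (model_union p pM) as [u [uM Hu]].
  exists u. split; [exact uM|]. intros z. rewrite (Hu z). split.
  - intros [w [wp zw]]. apply Hp in wp. destruct wp; subst w; [auto|].
    apply Hs in zw. tauto.
  - intros [zx| ->]; [exists x|exists s]; split; auto; [apply Hp|apply Hp|apply Hs]; auto.
Qed.

(** Without Powerset, Replacement is used twice: once to form each row {x} × b, once to collect the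
    rows, whose union is the product. *)
Lemma model_prod (a b : V) : a ∈ M -> b ∈ M ->
  exists w, w ∈ M /\ forall u, u ∈ w <-> exists x y, x ∈ a /\ y ∈ b /\ u = op x y.
Proof.
  intros aM bM.
  assert (row : forall x, x ∈ a ->
    exists r, r ∈ M /\ forall u, u ∈ r <-> exists y, y ∈ b /\ u = op x y).
  { intros x xa. assert (xM : x ∈ M) by exact (tM _ aM _ xa).
    destruct (model_repl (fun M y u x q r => u = op x y) ltac:(def) x x x b)
      as [r [rM Hr]]; auto.
    - intros y z z' _ _ _ -> ->. reflexivity.
    - exists r. split; [exact rM|]. intros u. rewrite (Hr u). split; [tauto|].
      intros [y [yb ->]]. split; [|eauto]. apply model_op; auto. exact (tM _ bM _ yb). }
  destruct (model_repl (fun M x r b p q =>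
      (forall u, u ∈ r -> exists y, y ∈ b /\ u = op x y) /\
      (forall y, y ∈ b -> op x y ∈ r)) ltac:(def) b b b a) as [R [RM HR]]; auto.
  { intros x r r' xa _ _ [H1 H2] [H1' H2']. apply set_ext. intros u. split; intros h.
    - destruct (H1 u h) as [y [yb ->]]. auto.
    - destruct (H1' u h) as [y [yb ->]]. auto. }
  destruct (model_union R RM) as [w [wM Hw]]. exists w. split; [exact wM|].
  intros u. rewrite (Hw u). split.
  - intros [r [rR ur]]. apply HR in rR. destruct rR as [_ [x [xa [H1 _]]]].
    destruct (H1 u ur) as [y [yb Hu]]. eauto.
  - intros [x [y [xa [yb Hu]]]]. destruct (row x xa) as [r [rM Hr]].
    exists r. split; [|apply Hr; eauto]. apply HR. split; [exact rM|].
    exists x. split; [exact xa|]. split.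
    + intros u' h. apply Hr, h.
    + intros y' h. apply Hr. eauto.
Qed.

End Model.

(** * Collapsing a definable well-founded relation *)

Section Collapse.
Context (lt : V -> V -> Prop) (Hlt : forall i j, Def (fun M v => lt (v i) (v j))).

(* [f] satisfies the Mostowski recursion f(p) = {f(q) : q ∈ W, q < p} on its domain. *)
Definition attempt (W f : V) : Prop :=
  forall p, p ∈ W -> forall g, op p g ∈ f ->
    (forall q, q ∈ W -> lt q p -> exists z, z ∈ g /\ op q z ∈ f) /\
    (forall z, z ∈ g -> exists q, q ∈ W /\ lt q p /\ op q z ∈ f).

Definition is_collapse (W f : V) : Prop :=
  (forall u, u ∈ f -> exists p g, p ∈ W /\ u = op p g) /\
  (forall p, p ∈ W -> exists g, op p g ∈ f) /\ attempt W f.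

Lemma def_attempt (i j : nat) : Def (fun M v => attempt (v i) (v j)).
Proof.
  unfold attempt.
  apply def_ext with (fun M v =>
    forall p, p ∈ v i -> forall g, g ∈ M -> op p g ∈ v j ->
    (forall q, q ∈ v i -> lt q p -> exists z, z ∈ g /\ op q z ∈ v j) /\
    (forall z, z ∈ g -> exists q, q ∈ v i /\ lt q p /\ op q z ∈ v j)); [|def].
  intros M v tM vM. split.
  - intros H p pi g _. apply H. exact pi.
  - intros H p pi g h. apply H; auto. apply (op_mem_trans M _ _ _ tM (vM j) h).
Qed.

Definition wf_on (W : V) : Prop := forall P : V -> Prop,
  (forall p, p ∈ W -> (forall q, q ∈ W -> lt q p -> P q) -> P p) -> forall p, p ∈ W -> P p.

(** By induction along [lt]: each value consists of the values at smaller points, where the attempts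
    agree. With [f = f'] this says that an attempt is single valued. *)
Lemma attempt_agree (W f f' : V) : wf_on W -> attempt W f -> attempt W f' ->
  forall p, p ∈ W -> forall g g', op p g ∈ f -> op p g' ∈ f' -> g = g'.
Proof.
  intros Hwf Hf Hf'. apply (Hwf (fun p => forall g g', op p g ∈ f -> op p g' ∈ f' -> g = g')).
  intros p pW IH g g' h h'.
  destruct (Hf p pW g h) as [A B], (Hf' p pW g' h') as [A' B'].
  apply set_ext. intros z. split; intros zg.
  - destruct (B z zg) as [q [qW [qp qz]]]. destruct (A' q qW qp) as [z' [z'g' qz']].
    rewrite (IH q qW qp z z' qz qz'). exact z'g'.
  - destruct (B' z zg) as [q [qW [qp qz]]]. destruct (A q qW qp) as [z' [z'g' qz']].
    rewrite <- (IH q qW qp z' z qz' qz). exact z'g'.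
Qed.

(** No model is mentioned, so collapses of the same relation found in different models coincide. *)
Lemma collapse_unique (W f f' : V) :
  wf_on W -> is_collapse W f -> is_collapse W f' -> f = f'.
Proof.
  intros Hwf [D [T A]] [D' [T' A']]. apply set_ext. intros u. split; intros h.
  - destruct (D u h) as [p [g [pW ->]]]. destruct (T' p pW) as [g' h'].
    now rewrite (attempt_agree W f f' Hwf A A' p pW g g' h h').
  - destruct (D' u h) as [p [g [pW ->]]]. destruct (T p pW) as [g' h'].
    now rewrite <- (attempt_agree W f f' Hwf A A' p pW g' g h' h).
Qed.

Section Existence.
Context {M : V} (HM : model M) (W : V) (WM : W ∈ M) (Hwf : wf_on W).
Context (Htrans : forall p q r, p ∈ W -> q ∈ W -> r ∈ W -> lt p q -> lt q r -> lt p r).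

Let good (p : V) : Prop := exists f, f ∈ M /\ attempt W f /\ exists g, op p g ∈ f.

(** Attempts agree, so Replacement in [M] can collect their values on [P] into [R] and their pairs
    into [F]. It is used for the predecessors of a point and then for the whole of [W]. *)
Lemma attempt_glue (P : V) : P ∈ M -> (forall p, p ∈ P -> p ∈ W /\ good p) ->
  (forall p q, p ∈ P -> q ∈ W -> lt q p -> q ∈ P) ->
  exists F R, F ∈ M /\ R ∈ M /\ attempt W F /\
    (forall p, p ∈ P -> exists g, g ∈ R /\ op p g ∈ F) /\
    (forall g, g ∈ R -> exists p, p ∈ P /\ op p g ∈ F) /\
    (forall u, u ∈ F -> exists p g, p ∈ P /\ u = op p g).
Proof.
  intros PM HP Hdown. pose proof (proj1 HM) as tM.
  destruct (model_repl HM (fun M p g W q r => exists f, f ∈ M /\ (attempt W f /\ op p g ∈ f)))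
    with (p := W) (q := W) (r := W) (a := P) as [R [RM HR]]; auto.
  { def_with ltac:(apply def_attempt). }
  { intros p g g' pP _ _ [f [_ [Hf h]]] [f' [_ [Hf' h']]].
    apply (attempt_agree W f f' Hwf Hf Hf' p); auto. apply HP, pP. }
  destruct (model_repl HM (fun M p u W q r => exists f, f ∈ M /\
      (attempt W f /\ exists g, g ∈ M /\ (op p g ∈ f /\ u = op p g))))
    with (p := W) (q := W) (r := W) (a := P) as [F [FM HF]]; auto.
  { def_with ltac:(apply def_attempt). }
  { intros p u u' pP _ _ [f [_ [Hf [g [_ [h ->]]]]]] [f' [_ [Hf' [g' [_ [h' ->]]]]]].
    f_equal. apply (attempt_agree W f f' Hwf Hf Hf' p); auto. apply HP, pP. }
  assert (FE : forall p g, op p g ∈ F <->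
                 p ∈ P /\ exists f, f ∈ M /\ attempt W f /\ op p g ∈ f).
  { intros p g. rewrite (HF (op p g)). split.
    - intros [_ [q [qP [f [fM [Hf [z [_ [h e]]]]]]]]]. apply op_inj in e. destruct e; subst q z.
      split; [exact qP|]. exists f. auto.
    - intros [pP [f [fM [Hf h]]]]. destruct (op_mem_trans M _ _ _ tM fM h).
      split; [apply (model_op HM); auto|]. exists p. split; [exact pP|].
      exists f. split; [exact fM|]. split; [exact Hf|]. exists g. auto. }
  exists F, R. split; [exact FM|]. split; [exact RM|]. split; [|split; [|split]].
  - intros p pW g h. apply FE in h. destruct h as [pP [f [fM [Hf h]]]].
    destruct (Hf p pW g h) as [A B]. split.
    + intros q qW qp. destruct (A q qW qp) as [z [zg hz]]. exists z. split; [exact zg|].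
      apply FE. split; [eauto|]. exists f. auto.
    + intros z zg. destruct (B z zg) as [q [qW [qp hz]]]. exists q. split; [exact qW|].
      split; [exact qp|]. apply FE. split; [eauto|]. exists f. auto.
  - intros p pP. destruct (HP p pP) as [pW [f [fM [Hf [g h]]]]]. exists g.
    split; [|apply FE; eauto 6]. apply HR.
    split; [apply (op_mem_trans M _ _ _ tM fM h)|]. exists p. split; [exact pP|]. eauto.
  - intros g gR. apply HR in gR. destruct gR as [_ [p [pP [f [fM [Hf h]]]]]].
    exists p. split; [exact pP|]. apply FE. eauto 6.
  - intros u h. apply HF in h. destruct h as [_ [p [pP [f [_ [_ [g [_ [_ ->]]]]]]]]]. eauto.
Qed.

Lemma attempt_exists (p : V) : p ∈ W -> good p.
Proof.
  apply Hwf. clear p. intros p pW IH. pose proof (proj1 HM) as tM.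
  assert (pM : p ∈ M) by exact (tM _ WM _ pW).
  destruct (model_sep HM (fun M q p r s t => lt q p)) with (p := p) (q := p) (r := p)
    (s := p) (a := W) as [P [PM HP]]; auto.
  destruct (attempt_glue P) as [F [R [FM [RM [HF [H1 [H2 H3]]]]]]]; auto.
  { intros q qP. apply HP in qP. destruct qP. auto. }
  { intros q r qP rW rq. apply HP in qP. destruct qP as [qW qp].
    apply HP. split; [exact rW|]. apply (Htrans r q p); auto. }
  (* The value at [p] has to be the set [R] of the values at its predecessors. *)
  destruct (model_adjoin HM F (op p R) FM (model_op HM p R pM RM)) as [f [fM Hf]].
  exists f. split; [exact fM|]. split; [|exists R; apply Hf; auto].
  intros q qW g h. apply Hf in h. destruct h as [h|e].
  - destruct (HF q qW g h) as [A B]. split.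
    + intros r rW rq. destruct (A r rW rq) as [z [zg hz]]. exists z.
      split; [exact zg|]. apply Hf. auto.
    + intros z zg. destruct (B z zg) as [r [rW [rq hz]]]. exists r.
      split; [exact rW|]. split; [exact rq|]. apply Hf. auto.
  - apply op_inj in e. destruct e; subst q g. split.
    + intros r rW rp. destruct (H1 r) as [z [zR hz]]; [apply HP; auto|].
      exists z. split; [exact zR|]. apply Hf. auto.
    + intros z zR. destruct (H2 z zR) as [r [rP hz]]. apply HP in rP. destruct rP.
      exists r. split; [assumption|]. split; [assumption|]. apply Hf. auto.
Qed.

Lemma collapse_exists : exists c, c ∈ M /\ is_collapse W c.
Proof.
  destruct (attempt_glue W) as [F [R [FM [RM [HF [H1 [H2 H3]]]]]]]; auto.
  { intros p pW. split; [exact pW|]. apply attempt_exists, pW. }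
  exists F. split; [exact FM|]. split; [exact H3|]. split; [|exact HF].
  intros p pW. destruct (H1 p pW) as [g [_ h]]. eauto.
Qed.

End Existence.
End Collapse.

(** * Ordinals and the Gödel well-ordering of pairs *)

Section Ordinal.
Context {k : V} (Ok : is_ordinal k).

Lemma ord_mem_trans (x y : V) : x ∈ y -> y ∈ k -> x ∈ k.
Proof. intros xy yk. exact (proj1 Ok y yk x xy). Qed.

Lemma ord_compare_in (x y : V) : x ∈ k -> y ∈ k -> x ∈ y \/ x = y \/ y ∈ x.
Proof. apply Ok. Qed.

Lemma ord_trans_in (x y z : V) : x ∈ y -> y ∈ z -> z ∈ k -> x ∈ z.
Proof.
  intros xy yz zk. assert (yk := ord_mem_trans _ _ yz zk). assert (xk := ord_mem_trans _ _ xy yk).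
  destruct (ord_compare_in x z xk zk) as [h|[->|h]]; [exact h|destruct (mem_asym _ _ xy yz)|].
  (* In the remaining case x ∈ y ∈ z ∈ x is a cycle, which Foundation excludes. *)
  destruct (mem_minimal (fun w => w = x \/ w = y \/ w = z) k) as [w [wk [Hw Hmin]]]; [eauto|].
  destruct Hw as [->|[->| ->]]; [destruct (Hmin z h zk)|destruct (Hmin x xy xk)
    |destruct (Hmin y yz yk)]; auto.
Qed.

Lemma ord_element (x : V) : x ∈ k -> is_ordinal x.
Proof.
  intros xk. split.
  - intros y yx z zy. exact (ord_trans_in z y x zy yx xk).
  - intros y z yx zx. apply ord_compare_in; eapply ord_mem_trans; eauto.
Qed.

Lemma ord_ind (P : V -> Prop) :
  (forall x, x ∈ k -> (forall y, y ∈ x -> P y) -> P x) -> forall x, x ∈ k -> P x.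
Proof.
  intros H x xk. apply NNPP. intros nP.
  destruct (mem_minimal (fun x => ~ P x) k) as [y [yk [Hy Hmin]]]; [eauto|].
  apply Hy, H; [exact yk|]. intros z zy. apply NNPP. apply Hmin; [exact zy|].
  exact (ord_mem_trans z y zy yk).
Qed.

(** The least element of [k] outside a proper transitive subset is equal to that subset. *)
Lemma ord_initial (c : V) : c ⊆ k -> is_transitive c -> c = k \/ c ∈ k.
Proof.
  intros ck tc. destruct (classic (exists x, x ∈ k /\ ~ x ∈ c)) as [h|h].
  - right. destruct (mem_minimal _ k h) as [x [xk [xc Hmin]]].
    replace c with x; [exact xk|]. apply set_ext. intros y. split; intros hy.
    + apply NNPP. apply Hmin; [exact hy|]. exact (ord_mem_trans y x hy xk).
    + destruct (ord_compare_in y x (ck y hy) xk) as [e|[e|e]]; [exact e|subst; tauto|].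
      destruct xc. exact (tc y hy x e).
  - left. apply set_ext. intros y. split; [apply ck|]. intros yk. apply NNPP. eauto.
Qed.
End Ordinal.

(** The intersection is an initial segment of both ordinals; if it were proper in both, it would be
    an element of itself. *)
Lemma ord_compare (a b : V) : is_ordinal a -> is_ordinal b -> a ∈ b \/ a = b \/ b ∈ a.
Proof.
  intros Oa Ob. destruct (sep_V (fun x => x ∈ b) a) as [c Hc].
  assert (tc : is_transitive c).
  { intros x xc y yx. apply Hc in xc. destruct xc as [xa xb]. apply Hc.
    split; [exact (ord_mem_trans Oa y x yx xa)|exact (ord_mem_trans Ob y x yx xb)]. }
  destruct (ord_initial Oa c) as [ea|ea]; [intros x h; apply Hc, h|exact tc| |];
    destruct (ord_initial Ob c) as [eb|eb]; try exact tc; try (intros x h; apply Hc, h);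
    subst; auto.
  destruct (mem_irrefl c). apply Hc. auto.
Qed.

Lemma ord_subset_or (a b : V) : is_ordinal a -> is_ordinal b -> a ∈ b \/ b ⊆ a.
Proof.
  intros Oa Ob. destruct (ord_compare a b Oa Ob) as [h|[->|h]]; [auto|right..].
  - intros x; auto.
  - exact (proj1 Oa b h).
Qed.

(* max(a, b) < max(a', b') *)
Definition max_lt (a b a' b' : V) : Prop := (a ∈ a' \/ a ∈ b') /\ (b ∈ a' \/ b ∈ b').

(** Maxima are compared first, then the pairs lexicographically. Failure of the reverse inequality
    stands in for equality of the maxima, and only memberships occur, which keeps the relation
    definable. *)
Definition goedel_lt (a b a' b' : V) : Prop :=
  max_lt a b a' b' \/ (~ max_lt a' b' a b /\ (a ∈ a' \/ (a = a' /\ b ∈ b'))).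

Definition glt (q p : V) : Prop :=
  exists a b a' b', q = op a b /\ p = op a' b' /\ goedel_lt a b a' b'.

Lemma glt_op (a b a' b' : V) : glt (op a b) (op a' b') <-> goedel_lt a b a' b'.
Proof.
  split.
  - intros [x [y [x' [y' [e [e' h]]]]]]. apply op_inj in e, e'.
    destruct e, e'. now subst.
  - intros h. exists a, b, a', b'. auto.
Qed.

Lemma def_glt (i j : nat) : Def (fun M v => glt (v i) (v j)).
Proof.
  apply def_ext with (fun M v => exists a, a ∈ M /\ exists b, b ∈ M /\
    exists a', a' ∈ M /\ exists b', b' ∈ M /\
    (v i = op a b /\ v j = op a' b' /\ goedel_lt a b a' b')).
  - intros M v tM vM. split.
    + intros [a [b [a' [b' [e [e' h]]]]]].
      assert (hi := vM i). assert (hj := vM j). rewrite e in hi. rewrite e' in hj.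
      apply (op_in_trans M _ _ tM) in hi, hj. destruct hi, hj.
      exists a. split; [assumption|]. exists b. split; [assumption|].
      exists a'. split; [assumption|]. exists b'. auto.
    + intros [a [_ [b [_ [a' [_ [b' [_ h]]]]]]]]. exists a, b, a', b'. exact h.
  - unfold goedel_lt, max_lt. def.
Qed.

Section Goedel.
Context {k : V} (Ok : is_ordinal k).

Definition omax (a b : V) : V := if excluded_middle_informative (a ∈ b) then b else a.

Lemma omax_lt (a b x : V) : a ∈ k -> b ∈ k -> x ∈ k ->
  (omax a b ∈ x <-> a ∈ x /\ b ∈ x).
Proof.
  intros ak bk xk. unfold omax. destruct (excluded_middle_informative _) as [h|h].
  - split; [|tauto]. intros bx. split; [exact (ord_trans_in Ok a b x h bx xk)|exact bx].
  - split; [|tauto]. intros ax. split; [exact ax|].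
    destruct (ord_compare_in Ok a b ak bk) as [e|[e|e]]; [tauto|now subst|].
    exact (ord_trans_in Ok b a x e ax xk).
Qed.

Lemma lt_omax (a b x : V) : a ∈ k -> b ∈ k -> (x ∈ omax a b <-> x ∈ a \/ x ∈ b).
Proof.
  intros ak bk. unfold omax. destruct (excluded_middle_informative _) as [h|h].
  - split; [tauto|]. intros [xa|xb]; [|exact xb]. exact (ord_trans_in Ok x a b xa h bk).
  - split; [tauto|]. intros [xa|xb]; [exact xa|].
    destruct (ord_compare_in Ok a b ak bk) as [e|[e|e]]; [tauto|now subst|].
    exact (ord_trans_in Ok x b a xb e ak).
Qed.

Lemma omax_in (a b : V) : a ∈ k -> b ∈ k -> omax a b ∈ k.
Proof. intros ak bk. unfold omax. destruct (excluded_middle_informative _); assumption. Qed.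

(** Below [k] the relation is the lexicographic order of the triples (maximum, first, second), so
    its order properties reduce to those of ∈ on [k]. *)
Lemma goedel_ltE (a b a' b' : V) : a ∈ k -> b ∈ k -> a' ∈ k -> b' ∈ k ->
  (goedel_lt a b a' b' <-> omax a b ∈ omax a' b' \/
     (omax a b = omax a' b' /\ (a ∈ a' \/ (a = a' /\ b ∈ b')))).
Proof.
  intros ak bk ak' bk'. unfold goedel_lt.
  assert (max_ltE : forall a b a' b', a ∈ k -> b ∈ k -> a' ∈ k -> b' ∈ k ->
    (max_lt a b a' b' <-> omax a b ∈ omax a' b')).
  { clear a b a' b' ak bk ak' bk'. intros. rewrite omax_lt by auto using omax_in.
    rewrite !lt_omax by auto.
    reflexivity. }
  rewrite !max_ltE by assumption.
  destruct (ord_compare_in Ok _ _ (omax_in a b ak bk) (omax_in a' b' ak' bk')) as [h|[h|h]].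
  - tauto.
  - rewrite h. split; [tauto|]. intros [e|e]; [auto|right]. split; [apply mem_irrefl|tauto].
  - split; [tauto|]. intros [e|[e _]]; [auto|]. rewrite e in h. destruct (mem_irrefl _ h).
Qed.

Context {W : V} (HW : forall u, u ∈ W <-> exists x y, x ∈ k /\ y ∈ k /\ u = op x y).

Lemma glt_trans (p q r : V) : p ∈ W -> q ∈ W -> r ∈ W -> glt p q -> glt q r -> glt p r.
Proof.
  intros Hp Hq Hr. apply HW in Hp, Hq, Hr.
  destruct Hp as [a [b [ak [bk ->]]]], Hq as [a1 [b1 [ak1 [bk1 ->]]]],
    Hr as [a2 [b2 [ak2 [bk2 ->]]]].
  rewrite !glt_op, !goedel_ltE by assumption.
  assert (m := omax_in a2 b2 ak2 bk2).
  intros [h1|[e1 h1]] [h2|[e2 h2]].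
  - left. exact (ord_trans_in Ok _ _ _ h1 h2 m).
  - left. now rewrite <- e2.
  - left. now rewrite e1.
  - right. split; [congruence|].
    destruct h1 as [h1|[-> h1]], h2 as [h2|[-> h2]]; auto.
    + left. exact (ord_trans_in Ok _ _ _ h1 h2 ak2).
    + right. split; [reflexivity|]. exact (ord_trans_in Ok _ _ _ h1 h2 bk2).
Qed.

Lemma glt_total (p q : V) : p ∈ W -> q ∈ W -> glt p q \/ p = q \/ glt q p.
Proof.
  intros Hp Hq. apply HW in Hp, Hq.
  destruct Hp as [a [b [ak [bk ->]]]], Hq as [a1 [b1 [ak1 [bk1 ->]]]].
  rewrite !glt_op, !goedel_ltE by assumption.
  destruct (ord_compare_in Ok _ _ (omax_in a b ak bk) (omax_in a1 b1 ak1 bk1)) as [h|[h|h]]; auto.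
  destruct (ord_compare_in Ok a a1 ak ak1) as [h1|[->|h1]]; auto 6.
  destruct (ord_compare_in Ok b b1 bk bk1) as [h2|[->|h2]]; auto 7.
Qed.

Lemma glt_wf : wf_on glt W.
Proof.
  intros P HP.
  (* Nested inductions on the maximum, the first and the second component. *)
  enough (H : forall m, m ∈ k -> forall a, a ∈ k -> forall b, b ∈ k ->
                omax a b = m -> P (op a b)).
  { intros p Hp. apply HW in Hp. destruct Hp as [a [b [ak [bk ->]]]].
    apply (H (omax a b)); auto using omax_in. }
  apply (ord_ind Ok (fun m => forall a, a ∈ k -> forall b, b ∈ k -> omax a b = m -> P (op a b))).
  intros m mk IHm.
  apply (ord_ind Ok (fun a => forall b, b ∈ k -> omax a b = m -> P (op a b))).
  intros a ak IHa.
  apply (ord_ind Ok (fun b => omax a b = m -> P (op a b))).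
  intros b bk IHb e. apply HP; [apply HW; eauto|].
  intros q Hq. apply HW in Hq. destruct Hq as [a' [b' [ak' [bk' ->]]]].
  rewrite glt_op, goedel_ltE by assumption. rewrite e. intros [h|[h [h1|[-> h1]]]].
  - exact (IHm _ h a' ak' b' bk' eq_refl).
  - exact (IHa a' h1 b' bk' h).
  - exact (IHb b' h1 h).
Qed.

(** The reason for comparing maxima first: the predecessors of a pair in d × d stay in d × d. *)
Lemma glt_bounded (a b a' b' d : V) : a ∈ k -> b ∈ k -> a' ∈ k -> b' ∈ k -> d ∈ k ->
  a ∈ d -> b ∈ d -> glt (op a' b') (op a b) -> a' ∈ d /\ b' ∈ d.
Proof.
  intros ak bk ak' bk' dk ad bd. rewrite glt_op, goedel_ltE by assumption. intros h.
  apply (omax_lt a' b' d); try assumption.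
  assert (omax a b ∈ d) as m by (apply omax_lt; auto).
  destruct h as [h|[-> _]]; [|exact m]. exact (ord_trans_in Ok _ _ _ h m dk).
Qed.

End Goedel.

(** * The collapse of a linear well-founded relation onto ordinals *)

Section LinearCollapse.
Context (lt : V -> V -> Prop) (W c : V) (Hc : is_collapse lt W c) (Hwf : wf_on lt W).
Context (Htrans : forall p q r, p ∈ W -> q ∈ W -> r ∈ W -> lt p q -> lt q r -> lt p r).
Context (Htotal : forall p q, p ∈ W -> q ∈ W -> lt p q \/ p = q \/ lt q p).

Lemma collapse_dom (p g : V) : op p g ∈ c -> p ∈ W.
Proof.
  intros h. destruct (proj1 Hc _ h) as [p' [g' [pW e]]]. apply op_inj in e.
  destruct e. now subst.
Qed.

Lemma collapse_fun (p g g' : V) : op p g ∈ c -> op p g' ∈ c -> g = g'.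
Proof.
  intros h h'. destruct Hc as [_ [_ A]].
  exact (attempt_agree lt W c c Hwf A A p (collapse_dom p g h) g g' h h').
Qed.

Lemma collapse_value (p g : V) : op p g ∈ c ->
  forall z, z ∈ g <-> exists q, lt q p /\ op q z ∈ c.
Proof.
  intros h z. assert (pW := collapse_dom p g h). destruct Hc as [_ [_ A]].
  destruct (A p pW g h) as [A1 A2]. split.
  - intros zg. destruct (A2 z zg) as [q [_ H]]. eauto.
  - intros [q [qp hz]]. destruct (A1 q (collapse_dom q z hz) qp) as [z' [zg hz']].
    now rewrite (collapse_fun q z z' hz hz').
Qed.

Lemma collapse_compare (p q x y : V) :
  op p x ∈ c -> op q y ∈ c -> (x = y /\ p = q) \/ (x ∈ y /\ lt p q) \/ (y ∈ x /\ lt q p).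
Proof.
  intros hp hq.
  destruct (Htotal p q (collapse_dom p x hp) (collapse_dom q y hq)) as [h|[->|h]].
  - right. left. split; [|exact h]. apply (collapse_value q y hq). eauto.
  - left. split; [exact (collapse_fun q x y hp hq)|reflexivity].
  - right. right. split; [|exact h]. apply (collapse_value p x hp). eauto.
Qed.

Lemma collapse_inj (p q x : V) : op p x ∈ c -> op q x ∈ c -> p = q.
Proof.
  intros hp hq.
  destruct (collapse_compare p q x x hp hq) as [[_ h]|[[h _]|[h _]]]; [exact h|..];
    destruct (mem_irrefl _ h).
Qed.

Lemma collapse_ordinal (p g : V) : op p g ∈ c -> is_ordinal g.
Proof.
  intros h. split.
  - intros z zg w wz. apply (collapse_value p g h) in zg. destruct zg as [q [qp hz]].
    apply (collapse_value q z hz) in wz. destruct wz as [r [rq hw]].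
    apply (collapse_value p g h). exists r. split; [|exact hw].
    apply (Htrans r q p); eauto using collapse_dom.
  - intros z z' zg zg'. apply (collapse_value p g h) in zg, zg'.
    destruct zg as [q [qp hz]], zg' as [q' [qp' hz']].
    destruct (collapse_compare q q' z z' hz hz') as [H|[H|H]]; tauto.
Qed.

End LinearCollapse.

(** * Powerset preserving embeddings *)

(** Here [J] acts on the whole universe, which avoids subtypes, and elementarity is stated for
    uniformly definable predicates with five parameters. *)
Record embedding (k M N : V) (J : V -> V) : Prop := {
  emb_model : model M;
  emb_trans : is_transitive N;
  emb_in : k ∈ M;
  emb_map : forall x, x ∈ M -> J x ∈ N;
  emb_elem : forall G : V -> V -> V -> V -> V -> V -> Prop,
    Def (fun M v => G M (v 0) (v 1) (v 2) (v 3) (v 4)) ->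
    forall p q r s t, p ∈ M -> q ∈ M -> r ∈ M -> s ∈ M -> t ∈ M ->
    (G M p q r s t <-> G N (J p) (J q) (J r) (J s) (J t));
  emb_ord : is_ordinal k;
  emb_moves : J k <> k;
  emb_fix : forall x, x ∈ k -> J x = x;
  emb_pow : forall x, x ⊆ k -> (x ∈ M <-> x ∈ N) }.

Lemma weakly_Ramsey_embedding (k : V) : weakly_Ramsey k ->
  forall A, A ⊆ k -> exists M N J, A ∈ M /\ embedding k M N J.
Proof.
  intros [_ H] A Ak.
  destruct (H A Ak) as [M [[tM [_ [kM ZM]]] [AM [N [j [_ [tN [Hel [Hcr Hpow]]]]]]]]].
  destruct Hcr as [Ok [[k0 [e0 Hmove]] Hfix]].
  (* Outside [M] the value is the default [x]. *)
  set (J := fun x => match excluded_middle_informative (x ∈ M) with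
                     | left h => val (j (exist (fun x => x ∈ M) x h)) | right _ => x end).
  assert (HJ : forall x (h : x ∈ M), J x = val (j (exist _ x h))).
  { intros x xM. unfold J. destruct (excluded_middle_informative _) as [h|h].
    - do 2 f_equal. apply elt_eq. reflexivity.
    - destruct (h xM). }
  exists M, N, J. split; [exact AM|]. split; try assumption.
  - split; assumption.
  - intros x xM. rewrite (HJ x xM). exact (proj2_sig (j _)).
  - intros G [f Hf] p q r s t Hp Hq Hr Hs Ht.
    set (v := scons (exist _ p Hp) (scons (exist _ q Hq) (scons (exist _ r Hr)
              (scons (exist _ s Hs) (fun _ => exist _ t Ht)))) : nat -> elt M).
    assert (h := Hf M tM v). cbn in h. rewrite <- h, (Hel f v), (Hf N tN). cbn.
    rewrite (HJ p Hp), (HJ q Hq), (HJ r Hr), (HJ s Hs), (HJ t Ht). reflexivity.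
  - rewrite (HJ k kM). replace (exist _ k kM) with k0; [exact Hmove|]. apply elt_eq, e0.
  - intros x xk. assert (xM : x ∈ M) by exact (tM _ kM _ xk).
    rewrite (HJ x xM). exact (Hfix (exist _ x xM) xk).
Qed.

Section Embedding.
Context {k M N : V} {J : V -> V} (HJ : embedding k M N J).

Let HM := emb_model _ _ _ _ HJ.
Let tM := proj1 HM.
Let Ok := emb_ord _ _ _ _ HJ.
Let kM := emb_in _ _ _ _ HJ.

Lemma emb_sub (x : V) : x ∈ k -> x ∈ M.
Proof. exact (tM _ kM x). Qed.

Lemma emb_mem (x y : V) : x ∈ M -> y ∈ M -> (x ∈ y <-> J x ∈ J y).
Proof.
  intros xM yM. exact (emb_elem _ _ _ _ HJ (fun M x y r s t => x ∈ y)
    ltac:(def) x y x x x xM yM xM xM xM).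
Qed.

Lemma emb_mem_fix (x y : V) : x ∈ k -> y ∈ M -> (x ∈ y <-> x ∈ J y).
Proof.
  intros xk yM. rewrite (emb_mem x y (emb_sub x xk) yM).
  now rewrite (emb_fix _ _ _ _ HJ x xk).
Qed.

Lemma emb_code (a b g c : V) : a ∈ M -> b ∈ M -> g ∈ M -> c ∈ M ->
  (op (op a b) g ∈ c <-> op (op (J a) (J b)) (J g) ∈ J c).
Proof.
  intros aM bM gM cM. exact (emb_elem _ _ _ _ HJ (fun M a b g c t => op (op a b) g ∈ c)
    ltac:(def) a b g c c aM bM gM cM cM).
Qed.

Lemma emb_code_fix (a b g c : V) : a ∈ k -> b ∈ k -> g ∈ k -> c ∈ M ->
  (op (op a b) g ∈ c <-> op (op a b) g ∈ J c).
Proof.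
  intros ak bk gk cM. rewrite (emb_code a b g c) by auto using emb_sub.
  now rewrite !(emb_fix _ _ _ _ HJ) by assumption.
Qed.

Lemma emb_image_sub : k ⊆ J k.
Proof. intros x xk. apply (emb_mem_fix x k xk kM), xk. Qed.

Lemma emb_image_ordinal : is_ordinal (J k).
Proof.
  exact (proj1 (emb_elem _ _ _ _ HJ (fun M x y r s t => is_ordinal x)
    ltac:(def_with ltac:(apply def_ordinal)) k k k k k kM kM kM kM kM) Ok).
Qed.

(** As [J] fixes the elements of [k], the ordinal [k] is an initial segment of [J k], and a proper
    one because [k] is moved. *)
Lemma emb_crit_in : k ∈ J k.
Proof.
  destruct (ord_initial emb_image_ordinal k emb_image_sub (proj1 Ok)) as [h|h]; [|exact h].
  destruct (emb_moves _ _ _ _ HJ). congruence.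
Qed.

Lemma emb_crit_N : k ∈ N.
Proof. exact (emb_trans _ _ _ _ HJ _ (emb_map _ _ _ _ HJ k kM) k emb_crit_in). Qed.

(** If [k] were empty or had a largest element x = J x, elementarity would give [J k] the same
    description, hence J k = k. *)
Lemma emb_crit_limit : is_limit k.
Proof.
  split; [exact Ok|]. split; apply NNPP; intros h.
  - assert (H : forall x, x ∈ J k -> False).
    { apply (emb_elem _ _ _ _ HJ (fun M k y r s t => forall x, x ∈ k -> False)
        ltac:(def) k k k k k kM kM kM kM kM). eauto. }
    apply (emb_moves _ _ _ _ HJ), set_ext. intros z. split; intros zk.
    + destruct (H z zk).
    + destruct h. eauto.
  - apply h. intros x xk. apply NNPP. intros h'.
    assert (H : forall y, y ∈ J k -> y = J x \/ y ∈ J x).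
    { apply (emb_elem _ _ _ _ HJ (fun M k x r s t => forall y, y ∈ k -> y = x \/ y ∈ x)
        ltac:(def) k x k k k kM (emb_sub x xk) kM kM kM).
      intros y yk. destruct (ord_compare_in Ok x y xk yk) as [e|[e|e]]; auto.
      destruct h'. eauto. }
    rewrite (emb_fix _ _ _ _ HJ x xk) in H.
    apply (emb_moves _ _ _ _ HJ), set_ext. intros z. split; [|apply emb_image_sub].
    intros zk. destruct (H z zk) as [->|zx]; [exact xk|]. exact (ord_mem_trans Ok z x zx xk).
Qed.

(** If there were no limit below [k], there would be none below [J k]; but [k] is one. *)
Lemma emb_crit_omega : exists w, is_omega w /\ w ∈ k.
Proof.
  destruct (classic (exists n, n ∈ k /\ is_limit n)) as [h|h].
  - destruct (mem_minimal _ k h) as [w [wk [Lw Hmin]]]. exists w. split; [|exact wk].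
    split; [exact Lw|]. intros n nw. apply Hmin; [exact nw|]. exact (ord_mem_trans Ok n w nw wk).
  - exfalso. assert (H : forall n, n ∈ J k -> ~ is_limit n).
    { apply (emb_elem _ _ _ _ HJ (fun M k x r s t => forall n, n ∈ k -> ~ is_limit n)
        ltac:(def_with ltac:(apply def_limit)) k k k k k kM kM kM kM kM). eauto. }
    exact (H k emb_crit_in emb_crit_limit).
Qed.

Lemma emb_crit_above (a b : V) : a ∈ k -> b ∈ k -> exists d, d ∈ k /\ a ∈ d /\ b ∈ d.
Proof.
  intros ak bk. destruct emb_crit_limit as [_ [_ L]].
  destruct (L (omax a b) (omax_in a b ak bk)) as [d [dk h]].
  exists d. split; [exact dk|]. now apply (omax_lt Ok).
Qed.

End Embedding.

(** What coding asks of a pairing function: a code below [k] for each pair from [k], and unambiguous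
    decoding. *)
Record pairing_on (k c : V) : Prop := {
  pairing_total : forall a b, a ∈ k -> b ∈ k -> exists g, g ∈ k /\ op (op a b) g ∈ c;
  pairing_inj : forall a b a' b' g, op (op a b) g ∈ c -> op (op a' b') g ∈ c ->
    a = a' /\ b = b' }.

(* If the value of the Gödel pairing at (a, b) were not below k, then all of k would be
   covered by the values on d × d for some d < k; reflecting this through J, the ordinal k
   itself would be such a value, hence in the range of J. *)
Lemma goedel_collapse_pairing {k M N : V} {J : V -> V} (HJ : embedding k M N J) (W c : V) :
  (forall u, u ∈ W <-> exists x y, x ∈ k /\ y ∈ k /\ u = op x y) ->
  is_collapse glt W c -> c ∈ M -> pairing_on k c.
Proof.
  intros HW Hc cM. assert (Ok := emb_ord _ _ _ _ HJ). assert (kM := emb_in _ _ _ _ HJ).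
  assert (tM := proj1 (emb_model _ _ _ _ HJ)).
  assert (wf := glt_wf Ok HW). assert (tr := glt_trans Ok HW). assert (tot := glt_total Ok HW).
  assert (small : forall a b g, a ∈ k -> b ∈ k -> op (op a b) g ∈ c -> g ∈ k).
  { intros a b g ak bk h.
    assert (Og := collapse_ordinal glt W c Hc wf tr tot _ _ h).
    destruct (ord_subset_or g k Og Ok) as [e|kg]; [exact e|exfalso].
    (* All predecessors of (a, b) lie in d × d, which [J] fixes pointwise. *)
    destruct (emb_crit_above HJ a b ak bk) as [d [dk [ad bd]]].
    assert (dM := emb_sub HJ d dk).
    assert (cover : forall x, x ∈ J k -> exists a', a' ∈ J d /\ exists b', b' ∈ J d /\
              op (op a' b') x ∈ J c).
    { apply (emb_elem _ _ _ _ HJ (fun M k d c s t => forall x, x ∈ k ->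
        exists a', a' ∈ d /\ exists b', b' ∈ d /\ op (op a' b') x ∈ c)
        ltac:(def) k d c c c kM dM cM cM cM).
      intros x xk. apply kg, (collapse_value glt W c Hc wf _ _ h) in xk.
      destruct xk as [q [qp hq]]. assert (qW := collapse_dom glt W c Hc _ _ hq).
      apply HW in qW. destruct qW as [a' [b' [ak' [bk' ->]]]].
      destruct (glt_bounded Ok a b a' b' d); auto. eauto 6. }
    rewrite (emb_fix _ _ _ _ HJ d dk) in cover.
    destruct (cover k (emb_crit_in HJ)) as [a' [ad' [b' [bd' hk]]]].
    assert (ak' := ord_mem_trans Ok _ _ ad' dk). assert (bk' := ord_mem_trans Ok _ _ bd' dk).
    destruct Hc as [Hdom [Htot Hatt]].
    destruct (Htot (op a' b')) as [z hz]; [apply HW; eauto|].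
    assert (Hc : is_collapse glt W c) by (split; auto).
    assert (zM : z ∈ M) by apply (op_mem_trans M _ _ _ tM cM hz).
    assert (hJz := hz). apply (emb_code HJ) in hJz;
      try (apply (emb_sub HJ); assumption); try assumption.
    rewrite !(emb_fix _ _ _ _ HJ) in hJz by assumption.
    (* By elementarity [J c] is single valued on d × d, so its values [k] and [J z] at (a', b')
       coincide. *)
    assert (Jfun : forall a, a ∈ J d -> forall b, b ∈ J d -> forall x, x ∈ N ->
              forall y, y ∈ N -> op (op a b) x ∈ J c -> op (op a b) y ∈ J c -> x = y).
    { apply (emb_elem _ _ _ _ HJ (fun M k d c s t => forall a, a ∈ d -> forall b, b ∈ d ->
        forall x, x ∈ M -> forall y, y ∈ M -> op (op a b) x ∈ c -> op (op a b) y ∈ c -> x = y)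
        ltac:(def) k d c c c kM dM cM cM cM).
      intros a1 _ b1 _ x _ y _. apply (collapse_fun glt W c Hc wf). }
    rewrite (emb_fix _ _ _ _ HJ d dk) in Jfun.
    assert (e : k = J z).
    { apply (Jfun a' ad' b' bd'); auto; [exact (emb_crit_N HJ)|exact (emb_map _ _ _ _ HJ z zM)]. }
    assert (Oz := collapse_ordinal glt W c Hc wf tr tot _ _ hz).
    (* No ordinal z satisfies J z = k: those below [k] are fixed, [k] is moved, and those above it
       go above [J k]. *)
    destruct (ord_compare z k Oz Ok) as [l|[l|l]].
    - rewrite (emb_fix _ _ _ _ HJ z l) in e. subst z. exact (mem_irrefl _ l).
    - subst z. exact (emb_moves _ _ _ _ HJ (eq_sym e)).
    - apply (emb_mem HJ) in l; auto. rewrite <- e in l. exact (mem_asym _ _ l (emb_crit_in HJ)). }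
  split.
  - intros a b ak bk. destruct Hc as [Hdom [Htot Hatt]].
    destruct (Htot (op a b)) as [g h]; [apply HW; eauto|]. exists g. split; [|exact h]. eauto.
  - intros a b a' b' g h h'. apply op_inj. exact (collapse_inj glt W c Hc wf tot _ _ _ h h').
Qed.

(** One pairing must serve all models, since a relation has to be coded before the model containing
    its code is chosen. Uniqueness of the collapse provides it. *)
Lemma universal_pairing (k : V) : weakly_Ramsey k ->
  exists c, pairing_on k c /\ forall M N J, embedding k M N J -> c ∈ M.
Proof.
  intros Hk.
  assert (H : forall M N J, embedding k M N J -> exists c W, c ∈ M /\
    (forall u, u ∈ W <-> exists x y, x ∈ k /\ y ∈ k /\ u = op x y) /\ is_collapse glt W c).
  { intros M N J HJ. assert (Ok := emb_ord _ _ _ _ HJ). assert (HM := emb_model _ _ _ _ HJ).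
    destruct (model_prod HM k k) as [W [WM HW]]; try apply (emb_in _ _ _ _ HJ).
    destruct (collapse_exists glt def_glt HM W WM (glt_wf Ok HW) (glt_trans Ok HW))
      as [c [cM Hc]]. exists c, W. auto. }
  destruct (weakly_Ramsey_embedding k Hk k (fun z h => h)) as [M [N [J [_ HJ]]]].
  destruct (H M N J HJ) as [c [W [cM [HW Hc]]]]. exists c.
  split; [exact (goedel_collapse_pairing HJ W c HW Hc cM)|].
  intros M' N' J' HJ'. destruct (H M' N' J' HJ') as [c' [W' [cM' [HW' Hc']]]].
  replace W' with W in *; [|apply set_ext; intros u; rewrite HW, HW'; reflexivity].
  now rewrite (collapse_unique glt W c c' (glt_wf (emb_ord _ _ _ _ HJ) HW) Hc Hc').
Qed.

(** * Coding binary relations by subsets *)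

(** [D] is read as a sequence of sets whose [a]-th term consists of those [b] for which the code of
    (a, b) lies in [D]. *)
Definition coded (c D a b : V) : Prop := exists g, g ∈ D /\ op (op a b) g ∈ c.

Lemma def_coded (i j m n : nat) : Def (fun M v => coded (v i) (v j) (v m) (v n)).
Proof. unfold coded. def. Qed.

Ltac def_c := def_with ltac:(first [apply def_coded | apply def_limit | apply def_club]).

Definition pair_closed (l c : V) : Prop :=
  forall a, a ∈ l -> forall b, b ∈ l -> exists g, g ∈ l /\ op (op a b) g ∈ c.

(** The code of [R] collects the codes of the related pairs. [R] may be any predicate of the
    metatheory. *)
Lemma code_relation {k c l : V} : pairing_on k c -> pair_closed l c ->
  forall R : V -> V -> Prop, exists D, D ⊆ l /\
    forall a b, a ∈ l -> b ∈ l -> (coded c D a b <-> R a b).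
Proof.
  intros Hp Hl R.
  destruct (sep_V (fun g => exists a b, op (op a b) g ∈ c /\ R a b) l) as [D HD].
  exists D. split; [intros g h; apply HD, h|]. intros a b al bl. split.
  - intros [g [gD h]]. apply HD in gD. destruct gD as [_ [a' [b' [h' r]]]].
    destruct (pairing_inj _ _ Hp _ _ _ _ _ h h'). now subst.
  - intros r. destruct (Hl a al b bl) as [g [gl h]]. exists g. split; [|exact h].
    apply HD. eauto.
Qed.

(** Regularity in relational form: a union of fewer than [l] bounded subsets of [l], indexed by an
    ordinal below [l], is bounded. *)
Definition bounding (l : V) : Prop := forall (R : V -> V -> Prop) a, a ∈ l ->
  (forall x, x ∈ a -> exists b, b ∈ l /\ forall y, y ∈ l -> R x y -> y ∈ b) ->
  exists b, b ∈ l /\ forall x, x ∈ a -> forall y, y ∈ l -> R x y -> y ∈ b.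

Lemma maps_dom (f a x y : V) : function_on f a -> maps f x y -> x ∈ a.
Proof.
  intros [Hdom _] [p [Hp pf]]. destruct (Hdom p pf) as [x' [y' [xa Hp']]].
  destruct (is_pair_inj _ _ _ _ _ Hp Hp'). now subst.
Qed.

Lemma bounding_function (l a f : V) : is_limit l -> bounding l -> a ∈ l ->
  is_function f a l -> exists b, b ∈ l /\ forall x y, maps f x y -> y ∈ b.
Proof.
  intros [_ [_ L]] B al [Hf Hran]. assert (Hfun := proj2 Hf).
  destruct (B (maps f) a al) as [b [bl Hb]].
  - intros x xa. destruct (Hfun x xa) as [y [hy Hy]].
    destruct (L y (Hran x y hy)) as [b [bl yb]]. exists b. split; [exact bl|].
    intros y' _ h. now rewrite <- (Hy y' h).
  - exists b. split; [exact bl|]. intros x y h. apply (Hb x); eauto using maps_dom.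
Qed.

Lemma bounding_regular (l : V) : is_limit l -> bounding l -> regular_cardinal l.
Proof.
  intros L B. split; [|split; [exact L|]].
  - split; [apply L|]. intros a al [f [Hf [_ Hsur]]].
    destruct (bounding_function l a f L B al Hf) as [b [bl Hb]].
    (* By surjectivity the strict bound [b] would itself be a value. *)
    destruct (Hsur b bl) as [x h]. exact (mem_irrefl b (Hb x b h)).
  - intros a f. apply bounding_function; assumption.
Qed.

(** Agreement tested element by element is the form that coded sequences can express. *)
Lemma agreement_setI (d l A s : V) : subset_sequence d l ->
  (forall a, a ∈ s <-> a ∈ l /\
     forall b, b ∈ a -> (b ∈ A <-> exists y, maps d a y /\ b ∈ y)) ->
  is_agreement_set s d A l.
Proof.
  intros [[_ Hfun] Hsub] Hs a. rewrite (Hs a). split.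
  - intros [al H]. split; [exact al|]. destruct (Hfun a al) as [y [hy Hy]].
    exists y. split; [exact hy|]. intros z. split.
    + intros zy. assert (za : z ∈ a) by exact (Hsub a y hy z zy).
      split; [|exact za]. apply H; eauto.
    + intros [zA za]. apply (H z za) in zA. destruct zA as [y' [hy' zy]].
      now rewrite (Hy y' hy').
  - intros [al [y [hy H]]]. split; [exact al|]. intros b ba. split.
    + intros bA. exists y. split; [exact hy|]. apply H. auto.
    + intros [y' [hy' by']]. apply H. destruct (Hfun a al) as [y0 [_ Hy0]].
      rewrite <- (Hy0 y hy), (Hy0 y' hy'). exact by'.
Qed.

(** * Reflecting coded sequences along an embedding *)

Section Reflection.
Context {k M N : V} {J : V -> V} (HJ : embedding k M N J) (c : V) (cM : c ∈ M).

Let tM := proj1 (emb_model _ _ _ _ HJ).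
Let Ok := emb_ord _ _ _ _ HJ.
Let kM := emb_in _ _ _ _ HJ.
Let fixk := emb_fix _ _ _ _ HJ.
Let elem := emb_elem _ _ _ _ HJ.

Lemma emb_coded (D a b : V) : D ⊆ k -> a ∈ k -> b ∈ k ->
  (coded c D a b <-> coded (J c) D a b).
Proof.
  intros Dk ak bk. split; intros [g [gD h]]; exists g; (split; [exact gD|]);
    apply (emb_code_fix HJ a b g c); auto.
Qed.

(** Each bound b < k satisfies J b = b and so still bounds the corresponding term of the image
    sequence. Hence in [N] the ordinal k < J k bounds all terms with index below [a], and
    elementarity gives a bound below [k]. *)
Lemma coded_bounding (D a : V) : D ∈ M -> a ∈ k ->
  (forall x, x ∈ a -> exists b, b ∈ k /\ forall y, y ∈ k -> coded c D x y -> y ∈ b) ->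
  exists b, b ∈ k /\ forall x, x ∈ a -> forall y, y ∈ k -> coded c D x y -> y ∈ b.
Proof.
  intros DM ak H. assert (aM := emb_sub HJ a ak).
  apply (elem (fun M k a c D t => exists b, b ∈ k /\ forall x, x ∈ a ->
    forall y, y ∈ k -> coded c D x y -> y ∈ b) ltac:(def_c) k a c D D kM aM cM DM DM).
  rewrite (fixk a ak). exists k. split; [exact (emb_crit_in HJ)|].
  intros x xa y yk h. destruct (H x xa) as [b [bk Hb]].
  assert (xk := ord_mem_trans Ok x a xa ak).
  assert (h' := proj1 (elem (fun M k x b c D => forall y, y ∈ k -> coded c D x y -> y ∈ b)
    ltac:(def_c) k x b c D kM (emb_sub HJ x xk) (emb_sub HJ b bk) cM DM) Hb).
  cbv beta in h'. rewrite (fixk x xk), (fixk b bk) in h'.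
  exact (ord_mem_trans Ok y b (h' y yk h) bk).
Qed.

(* The homogeneous set is the k-th slice of the image of the coded sequence; it lies in N,
   hence in M since the two models have the same subsets of k. *)
Lemma coded_homogeneous (D : V) : D ∈ M -> exists A, A ∈ M /\ A ⊆ k /\
  forall C, C ∈ M -> k ∈ J C ->
    exists a, a ∈ C /\ forall b, b ∈ a -> (b ∈ A <-> coded c D a b).
Proof.
  intros DM.
  (* The instance of Separation needed in [N] is obtained by proving it in [M] and transferring
     it. *)
  assert (slice : forall l, l ∈ N -> forall c, c ∈ N -> forall D, D ∈ N -> exists A, A ∈ N /\
    ((forall b, b ∈ A -> b ∈ l /\ coded c D l b) /\
     (forall b, b ∈ l -> coded c D l b -> b ∈ A))).
  { apply (elem (fun M x y r s t => forall l, l ∈ M -> forall c, c ∈ M -> forall D, D ∈ M ->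
      exists A, A ∈ M /\ ((forall b, b ∈ A -> b ∈ l /\ coded c D l b) /\
      (forall b, b ∈ l -> coded c D l b -> b ∈ A))) ltac:(def_c) k k k k k kM kM kM kM kM).
    intros l lM c' cM' D' DM'.
    destruct (model_sep (emb_model _ _ _ _ HJ) (fun M b l c D s => coded c D l b) ltac:(def_c)
      l c' D' D' l) as [A [AM HA]]; auto.
    exists A. split; [exact AM|]. split; intros b; [apply HA|]. intros bl h. apply HA. auto. }
  destruct (slice k (emb_crit_N HJ) (J c) (emb_map _ _ _ _ HJ c cM) (J D)
    (emb_map _ _ _ _ HJ D DM)) as [A [AN [HA1 HA2]]].
  assert (Ak : A ⊆ k) by (intros b bA; apply HA1, bA).
  assert (AM : A ∈ M) by (apply (emb_pow _ _ _ _ HJ); assumption).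
  exists A. split; [exact AM|]. split; [exact Ak|]. intros C CM kC.
  apply (elem (fun M C A c D t => exists a, a ∈ C /\ forall b, b ∈ a -> (b ∈ A <-> coded c D a b))
    ltac:(def_c) C A c D D CM AM cM DM DM).
  (* In [N] the index [k] is a witness, because J(A) ∩ k = A is the [k]-th term. *)
  exists k. split; [exact kC|]. intros b bk.
  rewrite <- (emb_mem_fix HJ b A bk AM). split; [apply HA1|apply HA2, bk].
Qed.

(** Apply the previous lemma to the final segment C of ordinals above [d]: since J d = d lies below
    [k], the ordinal [k] belongs to [J C]. *)
Lemma coded_homogeneous_unbounded (D : V) : D ∈ M -> exists A, A ∈ M /\ A ⊆ k /\
  forall d, d ∈ k ->
    exists a, a ∈ k /\ d ∈ a /\ forall b, b ∈ a -> (b ∈ A <-> coded c D a b).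
Proof.
  intros DM. destruct (coded_homogeneous D DM) as [A [AM [Ak H]]].
  exists A. split; [exact AM|]. split; [exact Ak|]. intros d dk. assert (dM := emb_sub HJ d dk).
  destruct (model_sep (emb_model _ _ _ _ HJ) (fun M a d q r s => d ∈ a) ltac:(def)
    d d d d k) as [C [CM HC]]; auto.
  destruct (H C CM) as [a [aC Ha]].
  - assert (h : forall a, a ∈ J k -> J d ∈ a -> a ∈ J C).
    { apply (elem (fun M k d C s t => forall a, a ∈ k -> d ∈ a -> a ∈ C)
        ltac:(def) k d C C C kM dM CM CM CM). intros a ak da. apply HC. auto. }
    rewrite (fixk d dk) in h. exact (h k (emb_crit_in HJ) dk).
  - apply HC in aC. destruct aC. eauto.
Qed.

(** Elements of [C] are fixed, so [J C] contains [C] and is unbounded in the limit [k]; being closed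
    in [J k], it contains [k]. *)
Lemma club_reflects (C : V) : C ∈ M -> club C k -> k ∈ J C.
Proof.
  intros CM HC.
  assert (HJC : club (J C) (J k)).
  { apply (elem (fun M C k r s t => club C k) ltac:(def_c) C k k k k CM kM kM kM kM). exact HC. }
  destruct HC as [Ck [Cub _]], HJC as [_ [_ Ccl]].
  apply Ccl; [exact (emb_crit_in HJ)|exact (emb_crit_limit HJ)|].
  intros b bk. destruct (Cub b bk) as [x [xC [xk bx]]]. exists x.
  split; [apply (emb_mem_fix HJ x C xk CM), xC|auto].
Qed.

End Reflection.

(** * Weakly Ramsey cardinals *)

(** The bijection is the collapse of [S] onto its order type, which is at most [k]. A smaller order
    type would make [S] bounded by regularity. *)
Lemma unbounded_cardinality {M : V} (HM : model M) (k S : V) :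
  is_limit k -> bounding k -> S ∈ M -> S ⊆ k ->
  (forall b, b ∈ k -> exists a, a ∈ S /\ b ∈ a) -> equinumerous S k.
Proof.
  intros L B SM Sk Hub. assert (Ok := proj1 L).
  assert (wf : wf_on mem S).
  { intros P HP p pS. apply (ord_ind Ok (fun p => p ∈ S -> P p)); auto. }
  assert (tr : forall p q r, p ∈ S -> q ∈ S -> r ∈ S -> p ∈ q -> q ∈ r -> p ∈ r).
  { intros p q r _ _ rS h h'. exact (ord_trans_in Ok p q r h h' (Sk r rS)). }
  assert (tot : forall p q, p ∈ S -> q ∈ S -> p ∈ q \/ p = q \/ q ∈ p).
  { intros p q pS qS. apply (ord_compare_in Ok); auto. }
  destruct (collapse_exists mem def_mem HM S SM wf tr) as [f [fM Hf]].
  assert (value := collapse_value mem S f Hf wf).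
  (* The collapse never sends a point above itself, so its values stay below [k]. *)
  assert (le : forall p, p ∈ S -> forall g, op p g ∈ f -> ~ p ∈ g).
  { apply (wf (fun p => forall g, op p g ∈ f -> ~ p ∈ g)).
    intros p pS IH g h pg. apply (value p g h) in pg. destruct pg as [q [qp hq]].
    exact (IH q (collapse_dom mem S f Hf q p hq) qp p hq qp). }
  assert (small : forall p g, op p g ∈ f -> g ∈ k).
  { intros p g h. assert (pS := collapse_dom mem S f Hf p g h).
    assert (Og := collapse_ordinal mem S f Hf wf tr tot p g h).
    destruct (ord_subset_or g k Og Ok) as [e|kg]; [exact e|].
    destruct (le p pS g h). apply kg, Sk, pS. }
  destruct (sep_V (fun g => exists p, op p g ∈ f) k) as [T HT].
  assert (TE : forall g, g ∈ T <-> exists p, op p g ∈ f).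
  { intros g. rewrite (HT g). split; [tauto|]. intros [p h]. eauto. }
  destruct (ord_initial Ok T) as [e|Tk].
  - intros g h. apply HT, h.
  - intros g gT z zg. apply TE in gT. destruct gT as [p h].
    apply (value p g h) in zg. destruct zg as [q [_ hq]]. apply TE. eauto.
  - subst T. exists f. split; [split; [split|]|split].
    + intros u h. destruct (proj1 Hf u h) as [p [g [pS e]]]. exists p, g.
      split; [exact pS|]. now apply is_pairE.
    + intros p pS. destruct (proj1 (proj2 Hf) p pS) as [g h]. exists g.
      split; [now apply mapsE|]. intros g' h'. apply mapsE in h'.
      exact (collapse_fun mem S f Hf wf p g g' h h').
    + intros p g h. apply mapsE in h. eauto.
    + intros p q g h h'. apply mapsE in h, h'.
      exact (collapse_inj mem S f Hf wf tot p q g h h').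
    + intros g gk. apply TE in gk. destruct gk as [p h]. exists p. now apply mapsE.
  (* An order type below [k]: the inverse collapse maps it cofinally into [k], against
     regularity. *)
  - exfalso. destruct (B (fun g p => op p g ∈ f) T Tk) as [b [bk Hb]].
    + intros g gT. apply TE in gT. destruct gT as [p h].
      destruct L as [_ [_ L]]. destruct (L p) as [b [bk pb]].
      { apply Sk. exact (collapse_dom mem S f Hf p g h). }
      exists b. split; [exact bk|]. intros p' _ h'.
      now rewrite <- (collapse_inj mem S f Hf wf tot p p' g h h').
    + destruct (Hub b bk) as [p [pS bp]]. destruct (proj1 (proj2 Hf) p pS) as [g h].
      apply (mem_asym b p bp). apply (Hb g); [apply TE; eauto|auto|exact h].
Qed.

Section WeaklyRamsey.
Context {k : V} (Hk : weakly_Ramsey k) {c : V} (Hc : pairing_on k c).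
Context (cM : forall M N J, embedding k M N J -> c ∈ M).

Lemma ramsey_closed : pair_closed k c.
Proof. intros a ak b bk. exact (pairing_total _ _ Hc a b ak bk). Qed.

(** Every relation on [k] enters, as a code, some model with an embedding; all later arguments start
    from this. *)
Lemma ramsey_code (R : V -> V -> Prop) : exists D M N J,
  D ∈ M /\ embedding k M N J /\
  forall a b, a ∈ k -> b ∈ k -> (coded c D a b <-> R a b).
Proof.
  destruct (code_relation Hc ramsey_closed R) as [D [Dk HD]].
  destruct (weakly_Ramsey_embedding k Hk D Dk) as [M [N [J [DM HJ]]]].
  exists D, M, N, J. auto.
Qed.

Lemma ramsey_limit : is_limit k.
Proof.
  (* The trivial relation serves to obtain some embedding. *)
  destruct (ramsey_code (fun _ _ => True)) as [D [M [N [J [DM [HJ _]]]]]].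
  exact (emb_crit_limit HJ).
Qed.

Lemma ramsey_omega : exists w, is_omega w /\ w ∈ k.
Proof.
  destruct (ramsey_code (fun _ _ => True)) as [D [M [N [J [DM [HJ _]]]]]].
  exact (emb_crit_omega HJ).
Qed.

Let Ok : is_ordinal k := proj1 ramsey_limit.

Lemma ramsey_bounding : bounding k.
Proof.
  intros R a ak H. destruct (ramsey_code R) as [D [M [N [J [DM [HJ HD]]]]]].
  destruct (coded_bounding HJ c (cM _ _ _ HJ) D a DM ak) as [b [bk Hb]].
  - intros x xa. destruct (H x xa) as [b [bk Hb]]. exists b. split; [exact bk|].
    intros y yk h. apply Hb; [exact yk|]. apply HD; auto.
    exact (ord_mem_trans Ok x a xa ak).
  - exists b. split; [exact bk|]. intros x xa y yk r. apply (Hb x xa y yk).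
    apply HD; auto. exact (ord_mem_trans Ok x a xa ak).
Qed.

Lemma ramsey_weakly_ineffable : weakly_ineffable k.
Proof.
  split; [split; [apply Hk|apply ramsey_omega]|].
  split; [exact (bounding_regular k ramsey_limit ramsey_bounding)|].
  intros d Hd.
  destruct (ramsey_code (fun a b => exists y, maps d a y /\ b ∈ y))
    as [D [M [N [J [DM [HJ HD]]]]]].
  assert (cM' := cM _ _ _ HJ). assert (HM := emb_model _ _ _ _ HJ).
  destruct (coded_homogeneous_unbounded HJ c cM' D DM) as [A [AM [Ak HA]]].
  (* The agreement set is formed inside [M], so that its order type can be computed there. *)
  destruct (model_sep HM (fun M a A c D s => forall b, b ∈ a -> (b ∈ A <-> coded c D a b))
    ltac:(def_c) A c D D k AM cM' DM DM (emb_in _ _ _ _ HJ)) as [S [SM HS]].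
  exists A, S. split; [exact Ak|]. split.
  - apply agreement_setI; [exact Hd|]. intros a. rewrite (HS a).
    split; intros [ak H]; (split; [exact ak|]); intros b ba; rewrite (H b ba);
      [|symmetry]; apply HD; auto; exact (ord_mem_trans Ok b a ba ak).
  - split; [apply Hk|].
    apply (unbounded_cardinality HM); auto using ramsey_limit, ramsey_bounding.
    + intros a h. apply HS, h.
    + intros b bk. destruct (HA b bk) as [a [ak [ba H]]]. exists a.
      split; [apply HS; auto|exact ba].
Qed.

(** At two indices above [l] where a homogeneous set A agrees with the sequence, both terms equal A
    ∩ l. *)
Lemma ramsey_strong_limit (l : V) (x : V -> V) : l ∈ k ->
  (forall a, a ∈ k -> x a ⊆ l) ->
  exists a b, a ∈ k /\ b ∈ k /\ a <> b /\ x a = x b.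
Proof.
  intros lk Hx.
  destruct (ramsey_code (fun a b => b ∈ x a)) as [D [M [N [J [DM [HJ HD]]]]]].
  destruct (coded_homogeneous_unbounded HJ c (cM _ _ _ HJ) D DM) as [A [AM [Ak HA]]].
  destruct (HA l lk) as [a [ak [la Ha]]], (HA a ak) as [b [bk [ab Hb]]].
  exists a, b. split; [exact ak|]. split; [exact bk|].
  split; [intros ->; exact (mem_irrefl b ab)|].
  apply set_ext. intros z.
  assert (H : z ∈ l -> (z ∈ x a <-> z ∈ x b)).
  { intros zl. assert (zk := ord_mem_trans Ok z l zl lk).
    assert (za := ord_trans_in Ok z l a zl la ak).
    assert (zb := ord_trans_in Ok z a b za ab bk).
    rewrite <- (HD a z ak zk), <- (HD b z bk zk), <- (Ha z za), <- (Hb z zb). reflexivity. }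
  split; intros h; apply H; auto; [apply (Hx a ak)|apply (Hx b bk)]; exact h.
Qed.

(** Well-order the power set of [l] by an ordinal m. If m were at least [k], inverting the bijection
    would list [k] distinct subsets of [l], against the previous lemma. *)
Lemma ramsey_powerset_injection (l : V) : l ∈ k ->
  exists e : V -> V, forall x, x ⊆ l -> e x ∈ k /\ forall y, y ⊆ l -> e x = e y -> x = y.
Proof.
  intros lk. destruct HV as [[_ [_ [_ [_ [_ WO]]]]] [PW _]].
  destruct (PW l) as [P HP], (WO P) as [m [Om [f [[[Hdom Hfun] Hran] [Hinj Hsur]]]]].
  destruct (ord_subset_or m k Om Ok) as [mk|km].
  - exists (fun x => epsilon (inhabits l) (fun y => maps f x y)).
    assert (He : forall x, x ⊆ l -> maps f x (epsilon (inhabits l) (fun y => maps f x y))).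
    { intros x xl. apply epsilon_spec. apply HP in xl. destruct (Hfun x xl) as [y [h _]]. eauto. }
    intros x xl. split.
    + exact (ord_mem_trans Ok _ m (Hran x _ (He x xl)) mk).
    + intros y yl e. apply (Hinj x y _ (He x xl)). rewrite e. exact (He y yl).
  - exfalso. set (x := fun a => epsilon (inhabits l) (fun y => maps f y a)).
    assert (Hx : forall a, a ∈ k -> maps f (x a) a).
    { intros a ak. apply epsilon_spec. apply Hsur, km, ak. }
    destruct (ramsey_strong_limit l x lk) as [a [b [ak [bk [ab e]]]]].
    + intros a ak. apply HP, (maps_dom f P (x a) a); auto. split; assumption.
    + apply ab. assert (ha := Hx a ak). assert (hb := Hx b bk). rewrite <- e in hb.
      destruct (Hfun (x a)) as [y [_ Hy]].
      { apply (maps_dom f P (x a) a); [split; assumption|exact ha]. }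
      now rewrite <- (Hy a ha), (Hy b hb).
Qed.

(** A single relation on [k] lists all bounded subsets: the index of x ⊆ l is the code of the pair
    (l, e_l(x)). A model containing the code of this relation recovers each x by Separation. *)
Lemma ramsey_full_model : exists M N J, embedding k M N J /\
  forall l x, l ∈ k -> x ⊆ l -> x ∈ M.
Proof.
  set (Q := fun l (e : V -> V) => forall x, x ⊆ l ->
              e x ∈ k /\ forall y, y ⊆ l -> e x = e y -> x = y).
  set (e := fun l => epsilon (inhabits (fun x => x)) (Q l)).
  assert (He : forall l, l ∈ k -> Q l (e l)).
  { intros l lk. apply epsilon_spec. exact (ramsey_powerset_injection l lk). }
  destruct (ramsey_code (fun i b =>
      exists l x, l ∈ k /\ x ⊆ l /\ op (op l (e l x)) i ∈ c /\ b ∈ x))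
    as [D [M [N [J [DM [HJ HD]]]]]].
  exists M, N, J. split; [exact HJ|]. intros l x lk xl.
  destruct (He l lk x xl) as [ek einj].
  destruct (ramsey_closed l lk (e l x) ek) as [i [ik hi]].
  assert (lM := emb_sub HJ l lk). assert (iM := emb_sub HJ i ik). assert (cM' := cM _ _ _ HJ).
  destruct (model_sep (emb_model _ _ _ _ HJ) (fun M b c D i s => coded c D i b)
    ltac:(def_c) c D i i l cM' DM iM iM lM) as [x' [xM' Hx']].
  replace x with x'; [exact xM'|]. apply set_ext. intros b. rewrite (Hx' b). split.
  - intros [bl h]. apply HD in h; [|exact ik|exact (ord_mem_trans Ok b l bl lk)].
    destruct h as [l' [y [lk' [yl [h by']]]]].
    destruct (pairing_inj _ _ Hc _ _ _ _ _ hi h) as [<- e']. now rewrite (einj y yl e').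
  - intros bx. assert (bl := xl b bx). split; [exact bl|].
    apply HD; [exact ik|exact (ord_mem_trans Ok b l bl lk)|]. exists l, x. auto.
Qed.

(* The statement "l is ineffable" relativized to M, with sequences and functions replaced
   by the subsets of l coding them through c. *)
Definition ineffable_coded (M l c : V) : Prop :=
  pair_closed l c /\ is_limit l /\
  (forall D, D ∈ M -> (forall g, g ∈ D -> g ∈ l) -> forall a, a ∈ l ->
    (forall x, x ∈ a -> exists b, b ∈ l /\ forall y, y ∈ l -> coded c D x y -> y ∈ b) ->
    exists b, b ∈ l /\ forall x, x ∈ a -> forall y, y ∈ l -> coded c D x y -> y ∈ b) /\
  (forall D, D ∈ M -> (forall g, g ∈ D -> g ∈ l) ->
    exists A, A ∈ M /\ ((forall g, g ∈ A -> g ∈ l) /\ forall C, C ∈ M -> club C l ->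
      exists a, a ∈ C /\ forall b, b ∈ a -> (b ∈ A <-> coded c D a b))).

Lemma def_ineffable_coded (i j : nat) : Def (fun M v => ineffable_coded M (v i) (v j)).
Proof. unfold ineffable_coded, pair_closed. def_c. Qed.

(** Sequences and clubs on [k] given in [N] already lie in [M], and the homogeneous set found in [M]
    lies in [N]. The parameter is [J c], the image of [c], which decodes subsets of [k] as [c]
    does. *)
Lemma ramsey_ineffable_in_target {M N : V} {J : V -> V} (HJ : embedding k M N J) :
  ineffable_coded N k (J c).
Proof.
  assert (cM' := cM _ _ _ HJ).
  split; [|split; [exact ramsey_limit|split]].
  - intros a ak b bk. destruct (ramsey_closed a ak b bk) as [g [gk h]]. exists g.
    split; [exact gk|]. apply (emb_code_fix HJ a b g c ak bk gk cM'), h.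
  - intros D DN Dk a ak H. assert (DM : D ∈ M) by (apply (emb_pow _ _ _ _ HJ); assumption).
    assert (sub : forall x y, x ∈ a -> y ∈ k -> (coded c D x y <-> coded (J c) D x y)).
    { intros x y xa yk. apply (emb_coded HJ c cM'); auto.
      exact (ord_mem_trans Ok x a xa ak). }
    destruct (coded_bounding HJ c cM' D a DM ak) as [b [bk Hb]].
    + intros x xa. destruct (H x xa) as [b [bk Hb]]. exists b. split; [exact bk|].
      intros y yk h. apply Hb; [exact yk|]. now apply sub.
    + exists b. split; [exact bk|]. intros x xa y yk h. apply (Hb x xa y yk). now apply sub.
  - intros D DN Dk. assert (DM : D ∈ M) by (apply (emb_pow _ _ _ _ HJ); assumption).
    destruct (coded_homogeneous HJ c cM' D DM) as [A [AM [Ak HA]]].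
    exists A. split; [apply (emb_pow _ _ _ _ HJ); assumption|]. split; [exact Ak|].
    intros C CN HC. assert (CM : C ∈ M) by (apply (emb_pow _ _ _ _ HJ); [apply HC|exact CN]).
    destruct (HA C CM (club_reflects HJ C CM HC)) as [a [aC Ha]].
    exists a. split; [exact aC|]. intros b ba. rewrite (Ha b ba).
    assert (ak : a ∈ k) by (apply HC, aC).
    apply (emb_coded HJ c cM'); auto. exact (ord_mem_trans Ok b a ba ak).
Qed.

(** All subsets of [l] lie in [M], so its quantifiers over codes and clubs miss none, and closure
    under pairing gives every relation on [l] a code. *)
Lemma ineffable_coded_correct (M l : V) : l ∈ k -> (forall x, x ⊆ l -> x ∈ M) ->
  (exists w, is_omega w /\ w ∈ l) -> ineffable_coded M l c -> ineffable l.
Proof.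
  intros lk full Hw [Hcl [L [Hb Hi]]].
  assert (Ol := ord_element Ok l lk).
  assert (B : bounding l).
  { intros R a al H. destruct (code_relation Hc Hcl R) as [D [Dl HD]].
    destruct (Hb D (full D Dl) Dl a al) as [b [bl HB]].
    - intros x xa. destruct (H x xa) as [b [bl HB]]. exists b. split; [exact bl|].
      intros y yl h. apply HB; [exact yl|]. apply HD; auto.
      exact (ord_mem_trans Ol x a xa al).
    - exists b. split; [exact bl|]. intros x xa y yl r. apply (HB x xa y yl).
      apply HD; auto. exact (ord_mem_trans Ol x a xa al). }
  assert (Rl := bounding_regular l L B).
  split; [split; [apply Rl|exact Hw]|]. split; [exact Rl|].
  intros d Hd.
  destruct (code_relation Hc Hcl (fun a b => exists y, maps d a y /\ b ∈ y)) as [D [Dl HD]].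
  destruct (Hi D (full D Dl) Dl) as [A [_ [Al HA]]].
  destruct (sep_V (fun a => forall b, b ∈ a -> (b ∈ A <-> coded c D a b)) l) as [s Hs].
  exists A, s. split; [exact Al|]. split.
  - apply agreement_setI; [exact Hd|]. intros a. rewrite (Hs a).
    split; intros [al H]; (split; [exact al|]); intros b ba; rewrite (H b ba);
      [|symmetry]; apply HD; auto; exact (ord_mem_trans Ol b a ba al).
  - split; [intros a h; apply Hs, h|]. intros C HC.
    destruct (HA C) as [a [aC Ha]]; [apply full, HC|exact HC|].
    exists a. split; [exact aC|]. apply Hs. split; [apply HC, aC|exact Ha].
Qed.

Lemma ramsey_limit_of_ineffable : limit_of ineffable k.
Proof.
  split; [exact ramsey_limit|]. intros b bk.
  destruct ramsey_full_model as [M [N [J [HJ full]]]].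
  destruct ramsey_omega as [w [Hw wk]].
  assert (bM := emb_sub HJ b bk). assert (wM := emb_sub HJ w wk).
  assert (H : exists l, l ∈ k /\ (b ∈ l /\ w ∈ l /\ ineffable_coded M l c)).
  (* In [N] the witness is [k] itself, above [b] and [w] and below [J k]. Having ω = w below l makes
     l uncountable. *)
  { apply (emb_elem _ _ _ _ HJ (fun M k b w c t =>
      exists l, l ∈ k /\ (b ∈ l /\ w ∈ l /\ ineffable_coded M l c))
      ltac:(def_with ltac:(apply def_ineffable_coded)) k b w c c);
      eauto using emb_in.
    rewrite (emb_fix _ _ _ _ HJ b bk), (emb_fix _ _ _ _ HJ w wk).
    exists k. split; [exact (emb_crit_in HJ)|]. split; [exact bk|]. split; [exact wk|].
    exact (ramsey_ineffable_in_target HJ). }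
  destruct H as [l [lk [bl [wl Hl]]]]. exists l. split; [exact lk|]. split; [exact bl|].
  apply (ineffable_coded_correct M l lk); eauto.
Qed.

End WeaklyRamsey.

End Universe.

Theorem theorem2p3 (V : Type) (E : Membership V) (HV : ZFC_universe V) (k : V)
    (Hk : weakly_Ramsey k) :
  weakly_ineffable k /\ limit_of ineffable k.
Proof.
  destruct (universal_pairing HV k Hk) as [c [Hc cM]]. split.
  - exact (ramsey_weakly_ineffable HV Hk Hc cM).
  - exact (ramsey_limit_of_ineffable HV Hk Hc cM).
Qed.
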